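(* Let $0<q<1$. (1) On the group $\mathfrak S^{\mathrm{adm}}$ of admissible permutations of $\mathbb Z$ the two notions of $q$-exchangeability coincide: a measure on $\mathfrak S^{\mathrm{adm}}$ is right $q$-exchangeable if and only if it is left $q$-exchangeable. (2) There exists a unique probability measure $\mathcal Q$ on the group $\mathfrak S^{\mathrm{bal}}$ of balanced permutations of $\mathbb Z$ which is both right and left $q$-exchangeable.
   Context: $\mathfrak S$ is the group of all bijections $\sigma:\mathbb Z\to\mathbb Z$, with $(\sigma\tau)(i)=\sigma(\tau(i))$. It carries the topology of pointwise convergence ($\sigma_n\to\sigma$ iff for each $i\in\mathbb Z$, $\sigma_n(i)=\sigma(i)$ for all large $n$); subsets carry the induced topology, and all measures are Borel. $\sigma\in\mathfrak S$ is admissible if both $\#\{j\ge 1:\sigma(j)\le 0\}$ and $\#\{j\le 0:\sigma(j)\ge 1\}$ are finite; its balance is $b(\sigma)=\#\{j\ge 1:\sigma(j)\le 0\}-\#\{j\le 0:\sigma(j)\ge 1\}$. It is balanced if it is admissible and $b(\sigma)=0$. $\mathfrak S^{\mathrm{adm}}$ and $\mathfrak S^{\mathrm{bal}}$ denote the subgroups of admissible, respectively balanced, permutations. For $i\in\mathbb Z$ let $\sigma_{i,i+1}$ be the transposition swapping $i$ and $i+1$, and let $\mathrm{sgn}(x)=\pm1$ be the sign of $x\neq0$. A measure $\mu$ is right $q$-exchangeable if for every $i\in\mathbb Z$ the pushforward $\mu_{i,i+1}$ of $\mu$ under $\sigma\mapsto\sigma\sigma_{i,i+1}$ is equivalent to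 $\mu$ and $\frac{d\mu_{i,i+1}}{d\mu}(\sigma)=q^{\mathrm{sgn}(\sigma(i+1)-\sigma(i))}$. It is left $q$-exchangeable if for every $i\in\mathbb Z$ the pushforward of $\mu$ under $\sigma\mapsto\sigma_{i,i+1}\sigma$ is equivalent to $\mu$, with Radon–Nikodým derivative with respect to $\mu$ at $\sigma$ equal to $q^{\mathrm{sgn}(\sigma^{-1}(i+1)-\sigma^{-1}(i))}$. *)

(* Defs.v *)
From HB Require Import structures.
From mathcomp Require Import all_boot all_order all_algebra finmap.
From mathcomp Require Import all_classical all_reals all_analysis.
From mathcomp Require Import zify.

Set Implicit Arguments.
Unset Strict Implicit.
Unset Printing Implicit Defensive.

Import Order.TTheory GRing.Theory Num.Theory.

Local Open Scope classical_set_scope.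
Local Open Scope ring_scope.

Definition bijections : set {ptws int -> discrete_topology int} :=
  [set f | bijective (f : int -> int)].

(* As a subspace of the product of copies of the discrete space int, this has
   the topology of pointwise convergence. *)
Definition permZ : Type := set_type bijections.

HB.instance Definition _ := SubChoice.copy permZ (set_type bijections).
HB.instance Definition _ := Topological.copy permZ (set_type bijections).

Definition perm_fun (s : permZ) : int -> int := \val s.
Coercion perm_fun : permZ >-> Funclass.

Definition mkperm (f : int -> int) (fP : bijective f) : permZ :=
  SigSub (mem_set fP : (f : {ptws int -> discrete_topology int}) \in bijections).

Lemma perm_bij (s : permZ) : bijective s.
Proof. exact: set_mem (valP s). Qed.

Lemma permP (s t : permZ) : s =1 t -> s = t.
Proof. by move=> st; apply/val_inj/funext. Qed.

Lemma permZ_inv_ex (s : permZ) :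
  {g : int -> int | cancel s g /\ cancel g s}.
Proof. by apply: cid; case: (perm_bij s) => g sK gK; exists g. Qed.

Lemma permZ_inv_bij (s : permZ) : bijective (sval (permZ_inv_ex s)).
Proof. by case: (svalP (permZ_inv_ex s)) => sK gK; exists s. Qed.

Definition permZ_one : permZ :=
  mkperm (Bijective (frefl id) (frefl id) : bijective (@id int)).
Definition permZ_mul (s t : permZ) : permZ :=
  mkperm (bij_comp (perm_bij s) (perm_bij t)).
Definition permZ_inv (s : permZ) : permZ := mkperm (permZ_inv_bij s).

Fact permZ_mulA : associative permZ_mul.
Proof. by move=> s t u; exact: permP. Qed.
Fact permZ_mul1 : left_id permZ_one permZ_mul.
Proof. by move=> s; exact: permP. Qed.
Fact permZ_mulr1 : right_id permZ_one permZ_mul.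
Proof. by move=> s; exact: permP. Qed.
Fact permZ_mulV : left_inverse permZ_one permZ_inv permZ_mul.
Proof. by move=> s; apply: permP; case: (svalP (permZ_inv_ex s)). Qed.
Fact permZ_mulrV : right_inverse permZ_one permZ_inv permZ_mul.
Proof. by move=> s; apply: permP; case: (svalP (permZ_inv_ex s)). Qed.

HB.instance Definition _ :=
  isMonoid.Build permZ permZ_mulA permZ_mul1 permZ_mulr1.
HB.instance Definition _ := hasInv.Build permZ permZ_inv.
HB.instance Definition _ := Monoid_isGroup.Build permZ permZ_mulV permZ_mulrV.

Lemma perm1E : perm_fun 1%g =1 id. Proof. by []. Qed.
Lemma permME (s t : permZ) (i : int) : perm_fun (s * t)%g i = s (t i).
Proof. by []. Qed.
Lemma permVK (s : permZ) : cancel s (perm_fun s^-1%g).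
Proof. by move=> i; rewrite -permME mulVg. Qed.
Lemma permKV (s : permZ) : cancel (perm_fun s^-1%g) s.
Proof. by move=> i; rewrite -permME mulgV. Qed.

Definition adj_swap (i j : int) : int :=
  if j == i then i + 1 else if j == i + 1 then i else j.

Lemma adj_swap_bij (i : int) : bijective (adj_swap i).
Proof.
have K : involutive (adj_swap i).
  by move=> j; rewrite /adj_swap; do !case: eqP => //; lia.
exact: inv_bij K.
Qed.

Definition transp (i : int) : permZ := mkperm (adj_swap_bij i).

Definition pos_to_nonpos (s : permZ) : set int := [set j | 1 <= j /\ s j <= 0].
Definition nonpos_to_pos (s : permZ) : set int := [set j | j <= 0 /\ 1 <= s j].

Definition admissible (s : permZ) : Prop :=
  finite_set (pos_to_nonpos s) /\ finite_set (nonpos_to_pos s).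

Definition balance (s : permZ) : int :=
  #|` fset_set (pos_to_nonpos s)|%fset%:Z
    - #|` fset_set (nonpos_to_pos s)|%fset%:Z.

Definition balanced (s : permZ) : Prop := admissible s /\ balance s = 0.

Definition adm_set : set permZ := [set s | admissible s].
Definition bal_set : set permZ := [set s | balanced s].

Lemma admissible1 : admissible 1%g.
Proof.
by split; apply: (@sub_finite_set _ _ set0) => // j []; rewrite perm1E /=; lia.
Qed.

Lemma admissibleM (s t : permZ) :
  admissible s -> admissible t -> admissible (s * t)%g.
Proof.
move=> [sp sn] [tp tn].
have fpre (A : set int) : finite_set A -> finite_set (t @^-1` A).
  move=> fA; apply: sub_finite_set (finite_image (perm_fun t^-1%g) fA).
  by move=> j /= Aj; exists (t j) => //; rewrite permVK.
split.
- apply: (@sub_finite_set _ _ (pos_to_nonpos t `|` t @^-1` pos_to_nonpos s)).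
    move=> j /= []; rewrite permME => j1 stj.
    by case: (lerP (t j) 0) => tj; [left | right]; split => //; lia.
  by rewrite finite_setU; split => //; exact: fpre.
- apply: (@sub_finite_set _ _ (nonpos_to_pos t `|` t @^-1` nonpos_to_pos s)).
    move=> j /= []; rewrite permME => j1 stj.
    by case: (lerP (t j) 0) => tj; [right | left]; split => //; lia.
  by rewrite finite_setU; split => //; exact: fpre.
Qed.

Lemma admissibleV (s : permZ) : admissible s -> admissible (s^-1)%g.
Proof.
move=> [sp sn]; split.
- apply: sub_finite_set (finite_image s sn) => j /= [j1 sj].
  by exists (perm_fun s^-1%g j); [split => //; rewrite permKV | rewrite permKV].
- apply: sub_finite_set (finite_image s sp) => j /= [j1 sj].
  by exists (perm_fun s^-1%g j); [split => //; rewrite permKV | rewrite permKV].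
Qed.

Lemma transp_moved (i j : int) : transp i j <> j -> j \in [fset i; (i + 1)%R]%fset.
Proof.
by rewrite /transp /perm_fun /= /adj_swap !inE; do !case: eqP => //.
Qed.

Lemma admissible_transp (i : int) : admissible (transp i).
Proof.
split; apply: (@sub_finite_set _ _ [set` [fset i; (i + 1)%R]%fset]);
  rewrite ?finite_fset//= => j /= [j1 tj]; apply: transp_moved; lia.
Qed.

Definition jump (s : permZ) (j : int) : int :=
  (1 <= j)%R%:R - (1 <= s j)%R%:R.

Lemma jump_supp (s : permZ) (j : int) :
  jump s j != 0 -> (pos_to_nonpos s `|` nonpos_to_pos s) j.
Proof.
rewrite /jump /=; case: (lerP 1 j) => j1; case: (lerP 1 (s j)) => sj //= _.
- by left; split => //; lia.
- by right; split => //; lia.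
Qed.

Lemma finite_jump (s : permZ) : admissible s -> finite_set [set j | jump s j != 0].
Proof.
move=> [sp sn]; apply: (@sub_finite_set _ _ _ (@jump_supp s)).
by rewrite finite_setU.
Qed.

Lemma sum_indic (A D : set int) : A `<=` D -> finite_set D ->
  \sum_(j \in D) ((j \in A)%:R : int) = #|` fset_set A|%fset%:Z.
Proof.
move=> AD fD; have fA := sub_finite_set AD fD.
rewrite -(fsbig_widen A D) //; last first.
  by move=> j [_ nA] /=; rewrite memNset.
rewrite fsbig_finite //= big_seq (eq_bigr (fun=> 1)); last first.
  by move=> j; rewrite in_fset_set // => ->.
by rewrite -big_seq big_const_seq count_predT iter_addr_0 natz.
Qed.

Lemma balanceE (s : permZ) : admissible s ->
  balance s = \sum_(j \in [set: int]) jump s j.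
Proof.
move=> [sp sn]; set D := pos_to_nonpos s `|` nonpos_to_pos s.
have fD : finite_set D by rewrite finite_setU.
rewrite -(fsbig_widen D setT) //; last first.
  by move=> j [_ nD] /=; apply: contrapT => /eqP /jump_supp.
transitivity (\sum_(j \in D)
    (((j \in pos_to_nonpos s)%:R : int) - (j \in nonpos_to_pos s)%:R)).
  rewrite fsbig_split //= sum_indic //; last by move=> j; left.
  rewrite /balance; congr (_ + _).
  rewrite -(@sum_indic (nonpos_to_pos s) D) //; last by move=> j; right.
  by rewrite !fsbig_finite // sumrN.
apply: eq_fsbigr => j _; rewrite /jump.
have -> : (j \in pos_to_nonpos s) = (1 <= j) && (s j <= 0).
  by apply/idP/andP; rewrite inE.
have -> : (j \in nonpos_to_pos s) = (j <= 0) && (1 <= s j).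
  by apply/idP/andP; rewrite inE.
by case: (lerP 1 j) => ?; case: (lerP (s j) 0) => ?; case: (lerP j 0) => ?;
   case: (lerP 1 (s j)) => ? //=; lia.
Qed.

Lemma balanceM (s t : permZ) : admissible s -> admissible t ->
  balance (s * t)%g = balance s + balance t.
Proof.
move=> As At; rewrite !balanceE //; last exact: admissibleM.
rewrite (reindex_fsbigT (t : int -> int) (jump s) (perm_bij t)) /=.
pose D : set int := [set j | jump s (t j) != 0] `|` [set j | jump t j != 0].
have fD : finite_set D.
  rewrite finite_setU; split; last exact: finite_jump.
  apply: sub_finite_set (finite_image (perm_fun t^-1%g) (finite_jump As)) => j /= nj.
  by exists (t j) => //; rewrite permVK.
have jM j : jump (s * t)%g j = jump s (t j) + jump t j.
  by rewrite /jump permME; lia.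
have out j : ~ D j -> jump s (t j) = 0 /\ jump t j = 0.
  by move=> /not_orP[] /negP/negPn/eqP-> /negP/negPn/eqP->.
have widen (f : int -> int) : (forall j, ~ D j -> f j = 0) ->
    \sum_(j \in setT) f j = \sum_(j \in D) f j.
  by move=> f0; rewrite -(fsbig_widen D setT) // => j [_ /f0].
rewrite (widen (jump (s * t)%g)); last by move=> j /out[a b]; rewrite jM a b.
rewrite (widen (jump t)); last by move=> j /out[].
rewrite (widen (fun j => jump s (t j))); last by move=> j /out[].
by rewrite -fsbig_split //; apply: eq_fsbigr => j _; rewrite jM.
Qed.

Lemma balance1 : balance 1%g = 0.
Proof.
by rewrite balanceE ?fsbig1 // => [j _|]; [rewrite /jump subrr | exact: admissible1].
Qed.

Lemma balance_transp (i : int) : balance (transp i) = 0.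
Proof.
have At := admissible_transp i; have := balanceM At At.
suff -> : (transp i * transp i)%g = 1%g by rewrite balance1; lia.
apply: permP => j; rewrite permME /transp /perm_fun /= /adj_swap.
by do !case: eqP => //; lia.
Qed.

Lemma adm_group_closed : group_closed (fun s : permZ => s \in adm_set).
Proof.
split=> [|s t]; rewrite !unfold_in ?inE; first exact: admissible1.
by move=> As At; apply: admissibleM => //; exact: admissibleV.
Qed.

Lemma bal_group_closed : group_closed (fun s : permZ => s \in bal_set).
Proof.
split=> [|s t]; rewrite !unfold_in ?inE.
  by split; [exact: admissible1 | exact: balance1].
move=> [As bs] [At bt]; have AV := admissibleV At.
split; first exact: admissibleM.
rewrite balanceM // bs add0r.
by have := balanceM At AV; rewrite mulgV balance1 bt add0r.
Qed.

(* Subgroups of permZ stable under both families of translations by adjacent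
   transpositions. *)
Record transp_subgroup := TranspSubgroup {
  tsg_set :> set permZ;
  tsg_closed : group_closed (fun s : permZ => s \in tsg_set);
  tsg_transp : forall i : int, transp i \in tsg_set }.

Definition tsg_type (H : transp_subgroup) : Type := set_type H.

HB.instance Definition _ (H : transp_subgroup) :=
  SubChoice.copy (tsg_type H) (set_type H).
HB.instance Definition _ (H : transp_subgroup) :=
  Topological.copy (tsg_type H) (set_type H).
HB.instance Definition _ (H : transp_subgroup) :=
  SubChoice_isSubGroup.Build permZ _ (tsg_type H) (tsg_closed H).
HB.instance Definition _ (H : transp_subgroup) :=
  isPointed.Build (tsg_type H) 1%g.

Definition tsg_adj (H : transp_subgroup) (i : int) : tsg_type H :=
  SigSub (tsg_transp H i).

Lemma adm_transp (i : int) : transp i \in adm_set.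
Proof. by rewrite inE; exact: admissible_transp. Qed.

Lemma bal_transp (i : int) : transp i \in bal_set.
Proof.
by rewrite inE; split; [exact: admissible_transp | exact: balance_transp].
Qed.

Definition Sadm : transp_subgroup := TranspSubgroup adm_group_closed adm_transp.
Definition Sbal : transp_subgroup := TranspSubgroup bal_group_closed bal_transp.

Notation borel H := (g_sigma_algebraType (@open (tsg_type H))).

Section q_exchangeability.
Context {R : realType} (q : R) (H : transp_subgroup).

Definition right_transl (i : int) (s : borel H) : borel H :=
  ((s : tsg_type H) * tsg_adj H i)%g.

Definition left_transl (i : int) (s : borel H) : borel H :=
  (tsg_adj H i * (s : tsg_type H))%g.

Definition right_weight (i : int) (s : borel H) : R :=
  let s' : permZ := \val (s : tsg_type H) in
  q ^ Num.sg (s' (i + 1) - s' i).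

Definition left_weight (i : int) (s : borel H) : R :=
  let s' : permZ := \val (s : tsg_type H) in
  q ^ Num.sg (perm_fun s'^-1%g (i + 1) - perm_fun s'^-1%g i).

Definition equivalent_measures (nu mu : set (borel H) -> \bar R) : Prop :=
  nu `<< mu /\ mu `<< nu.

(* f is a version of d nu / d mu.  No sigma-finiteness is assumed, so the
   library's Radon-Nikodym derivative does not apply. *)
Definition is_density (nu : set (borel H) -> \bar R)
    (mu : {measure set (borel H) -> \bar R}) (f : borel H -> R) : Prop :=
  measurable_fun setT f /\
  forall A : set (borel H), measurable A ->
    nu A = (\int[mu]_(s in A) (f s)%:E)%E.

Definition right_q_exchangeable (mu : {measure set (borel H) -> \bar R}) :=
  forall i : int,
    equivalent_measures (pushforward mu (right_transl i)) mu /\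
    is_density (pushforward mu (right_transl i)) mu (right_weight i).

Definition left_q_exchangeable (mu : {measure set (borel H) -> \bar R}) :=
  forall i : int,
    equivalent_measures (pushforward mu (left_transl i)) mu /\
    is_density (pushforward mu (left_transl i)) mu (left_weight i).

End q_exchangeability.

(* Main.v *)
From HB Require Import structures.
Require Import Defs.
From mathcomp Require Import all_boot all_order all_algebra finmap.
From mathcomp Require Import all_classical all_reals all_analysis.
From mathcomp Require Import measurable_realfun zify ring lra.

Set Implicit Arguments.
Unset Strict Implicit.
Unset Printing Implicit Defensive.

Import Order.TTheory GRing.Theory Num.Theory.

Local Open Scope classical_set_scope.
Local Open Scope ring_scope.

(** Translating by an adjacent transposition is an involution that exchanges the ascents
and the descents at a given place, and the prescribed density is q on the former and 1/q
on the latter.  Exchangeability is therefore a scaling rule: the translate of a measurable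
set of ascents has q times its mass ([right_exchP], [left_exchP]).

Right and left exchangeability agree on every group of permutations considered here.
Suppose that the values i and i+1 sit at positions a < b.  Exchanging these two values is
the same as exchanging the entries at a and b.  Conjugating by the exchange of positions
b-1 and b brings the two values closer, and the two conjugating exchanges contribute
factors that cancel, because the entry at b-1 lies on the same side of i and of i+1.
Induction on b - a gives the factor q ([left_transl_adjacent]), and countable additivity
over the pairs (a, b) turns right exchangeability into left exchangeability.  Inversion
swaps the two notions, which gives the converse ([right_iff_left]).  Since only scaling
and countable additivity are used, the measure may be infinite.

For balanced permutations, fix the window of positions 1-m, ..., m and consider the
cylinders of those permutations that are non-positive to the left of the window, positive
to its right, and take prescribed values in it.  Every balanced permutation lies in such a
cylinder once m is large, and the cylinders determine finite measures ([cyl_measure_eq]).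
The candidate for the mass of the cylinder of s is, up to normalization,
  (1-q)^(2m) q^(inv + sum |s j| - m^2),
where inv counts the inversions of s in the window and the sum runs over the window
([weight]).

Uniqueness.  Exchanging two adjacent positions of the window, or two adjacent values of
the same sign of which one is taken in the window, maps cylinders to cylinders, and the
order of the exchanged entries is constant on each of them.  Such moves reduce any cylinder to that of the
identity ([bal_reduction]), so for a fixed m the masses of an exchangeable measure are
proportional to the weights ([cylof_weight]).  A cylinder of one window is a disjoint
union of cylinders of the next one, so the constant of proportionality does not depend
on m, and the total mass fixes it ([exch_unique]).

Existence.  A measure with these cylinder masses is right exchangeable, because a swap of
two ascending positions adds one inversion and keeps the sum of absolute values
([cylof_weight_exch]).  To produce one, read a uniform number of ]0,1] in a self-similar
partition whose digits are independent geometric variables.  The k-th digit selects the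
rank, among the values still unused, of the k-th value of a permutation; almost surely
infinitely many digits vanish, so that every value gets used ([value_surj]).  Even and odd
digits give independent permutations of the positive and of the non-positive integers,
hence a law on sign-preserving permutations ([sign_law_cylof]).  A general balanced
permutation is obtained from a sign-preserving one by adjacent swaps that only depend on
its word of signs, each swap costing a factor q ([sorting_ex]).  Summing over the countably
many words gives the measure ([mallows_sum]).  It is finite, since a word with minus signs
at positive positions d and plus signs at non-positive positions u requires at least half
of sum d + sum (1-u) swaps, and the corresponding sum is dominated by the convergent
product of the (1 + q^(k/2))^2 ([mass_bound]).  Its normalization is the measure sought. *)

(** * Topology and measurability on groups of permutations *)

Definition act (H : transp_subgroup) (s : borel H) : int -> int :=
  perm_fun (\val (s : tsg_type H)).

Lemma act_inj (H : transp_subgroup) (s t : borel H) : act s =1 act t -> s = t.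
Proof. by move=> st; apply: val_inj; apply: Defs.permP. Qed.

(** The sets of maps agreeing with s on a window form a filter base converging to s
    coordinate by coordinate, hence in the product topology; so they enter every
    neighbourhood of s. *)
Lemma open_window (H : transp_subgroup) (U : set (tsg_type H)) (s : tsg_type H) :
  open U -> U s ->
  exists N : nat, [set t | forall j : int, (`|j| <= N)%N -> act t j = act s j]
                  `<=` U.
Proof.
move=> [V [W oW <-] <-] /= Ws.
pose F := filter_from [set: nat] (fun N : nat =>
  [set f : int -> int | forall j : int, (`|j| <= N)%N -> f j = act s j]).
have FF : Filter F.
  apply: filter_from_filter; first by exists 0%N.
  move=> m n _ _; exists (maxn m n) => // f fs; split=> j jm;
    by apply: fs; rewrite leq_max jm ?orbT.
have Fs : F --> (act s : {ptws int -> discrete_topology int}).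
  apply/cvg_sup => j B; rewrite nbhsE => -[C [[D _ DC] Cs]] CB.
  exists `|j|%N => // f fs; apply: CB; rewrite -DC /= fs //.
  by rewrite -DC in Cs.
have /Fs : nbhs (act s : {ptws int -> discrete_topology int}) W.
  exact: open_nbhs_nbhs.
by case=> N _ NW; exists N => t ts; exact: NW.
Qed.

Lemma open_eval (H : transp_subgroup) (j a : int) :
  open [set s : tsg_type H | act s j = a].
Proof.
exists (val @^-1` [set f : {ptws int -> discrete_topology int} | f j = a]) => //.
exists [set f : {ptws int -> discrete_topology int} | f j = a] => //.
have cj : continuous (fun f : {ptws int -> discrete_topology int} => f j).
  exact: (@proj_continuous int (fun=> discrete_topology int) j).
move/continuousP: cj => /(_ [set a]) /=; apply.
exact: discrete_open.
Qed.

(** The window is centred at 1/2, with m positive and m non-positive positions, so that a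
    sign-preserving permutation can fill it with values of matching signs. *)
Definition win (m : nat) : seq int := [seq k%:Z + 1 - m%:Z | k <- iota 0 (m + m)].

Lemma mem_win (m : nat) (j : int) : (j \in win m) = (1 - m%:Z <= j <= m%:Z).
Proof.
apply/mapP/idP => [[k]|jm]; first by rewrite mem_iota => km ->; lia.
exists (absz (j - 1 + m%:Z)); last by lia.
by rewrite mem_iota; lia.
Qed.

Lemma win_uniq m : uniq (win m).
Proof. by rewrite map_inj_uniq ?iota_uniq // => a b /=; lia. Qed.

Lemma act_win (H : transp_subgroup) (s t : borel H) m :
  (map (act t) (win m) = map (act s) (win m)) <->
  {in win m, act t =1 act s}.
Proof. by split=> [/eq_in_map|/eq_in_map]. Qed.

Section generation.
Context (H : transp_subgroup).

(** A countable union, since windows and finite lists of values are countable: this is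
    what makes the Borel sets accessible through finitely many coordinates. *)
Lemma open_bigcup_win (U : set (tsg_type H)) : open U ->
  U = \bigcup_(c : nat * seq int)
        [set s | map (act s) (win c.1) = c.2 /\
                 [set t : tsg_type H | map (act t) (win c.1) = c.2] `<=` U].
Proof.
move=> oU; apply/seteqP; split=> [s Us|s [c _ [sc]]]; last exact.
have [N NU] := open_window oU Us.
exists (N.+1, map (act s) (win N.+1)) => //; split=> // t /act_win ts.
by apply: NU => j jN; apply: ts; rewrite mem_win /=; lia.
Qed.

Lemma win_fibre (m : nat) (l : seq int) :
  [set s : tsg_type H | map (act s) (win m) = l] =
  if size l == (m + m)%N then
    \bigcap_(k in `I_(m + m)) [set s : tsg_type H |
       act s (nth 0 (win m) k) = nth 0 l k]
  else set0.
Proof.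
have sw : size (win m) = (m + m)%N by rewrite size_map size_iota.
case: ifPn => sl; last first.
  by apply/seteqP; split=> // s /= sE; move: sl; rewrite -sE size_map sw eqxx.
apply/seteqP; split=> s /= sE.
  by move=> k /= km; rewrite -sE (nth_map 0 0 (act s)) ?sw.
apply: (@eq_from_nth _ 0); first by rewrite size_map sw (eqP sl).
by move=> k; rewrite size_map sw => km; rewrite (nth_map 0 0 (act s)) ?sw //; exact: sE.
Qed.

Lemma open_sub_sigma (G : set (set (tsg_type H))) :
  (forall j a : int, <<s G >> [set s | act s j = a]) ->
  forall U, open U -> <<s G >> U.
Proof.
move=> Gja U oU; rewrite (open_bigcup_win oU).
pose GT := g_sigma_algebraType G.
apply: (@countable_bigcupT_measurable _ GT) => [|c]; first exact: countableP.
case: (pselect ([set t : tsg_type H | map (act t) (win c.1) = c.2] `<=` U)) => cU.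
  rewrite (_ : [set s | _] = [set s : tsg_type H | map (act s) (win c.1) = c.2]).
    rewrite win_fibre; case: ifP => _; last exact: (@measurable0 _ GT).
    apply: (@bigcap_measurableType _ GT) => // k _; exact: Gja.
  by apply/seteqP; split=> s //= [].
rewrite (_ : [set s | _] = set0); first exact: (@measurable0 _ GT).
by apply/seteqP; split=> s //= [].
Qed.

Lemma measurable_eval (j a : int) : measurable [set s : borel H | act s j = a].
Proof. by apply: sub_sigma_algebra; exact: open_eval. Qed.

Lemma measurable_into d (T : measurableType d) (f : T -> borel H) :
  (forall j a, measurable [set t | act (f t) j = a]) -> measurable_fun setT f.
Proof.
move=> fja _; apply: (@measurability _ _ _ (borel H) setT f (@open (tsg_type H))) => //.
move=> _ [U oU <-]; rewrite setTI (open_bigcup_win oU) preimage_bigcup.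
apply: countable_bigcupT_measurable => [|c]; first exact: countableP.
case: (pselect ([set t : tsg_type H | map (act t) (win c.1) = c.2] `<=` U)) => cU.
  rewrite (_ : [set s | _] = [set s : tsg_type H | map (act s) (win c.1) = c.2]).
    rewrite win_fibre; case: ifP => _; last by rewrite preimage_set0.
    rewrite preimage_bigcap; apply: bigcap_measurableType => // k _; exact: fja.
  by apply/seteqP; split=> s //= [].
rewrite (_ : [set s | _] = set0) ?preimage_set0 //.
by apply/seteqP; split=> s //= [].
Qed.

(** Only countably many pairs of values are possible, so any relation between two
    coordinates is measurable. *)
Lemma measurable_rel (r : rel int) (i j : int) :
  measurable [set s : borel H | r (act s i) (act s j)].
Proof.
rewrite (_ : [set _ | _] = \bigcup_(c : int * int)
   (if r c.1 c.2 then [set s : borel H | act s i = c.1] `&`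
                      [set s : borel H | act s j = c.2] else set0)).
  apply: countable_bigcupT_measurable => [|c]; first exact: countableP.
  by case: ifP => _ //; apply: measurableI; exact: measurable_eval.
apply/seteqP; split=> [s /= rs|s [c _]]; first by exists (act s i, act s j); rewrite //= rs.
by case: ifP => //= rc [-> ->].
Qed.

Definition inv_borel (s : borel H) : borel H := ((s : tsg_type H)^-1)%g.

Lemma act_right i (s : borel H) j : act (right_transl i s) j = act s (adj_swap i j).
Proof. by []. Qed.

Lemma act_left i (s : borel H) j : act (left_transl i s) j = adj_swap i (act s j).
Proof. by []. Qed.

Lemma act_invK (s : borel H) : cancel (act s) (act (inv_borel s)).
Proof. by move=> j; exact: permVK. Qed.

Lemma act_Kinv (s : borel H) : cancel (act (inv_borel s)) (act s).
Proof. by move=> j; exact: permKV. Qed.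

Lemma inv_borelK : involutive inv_borel.
Proof. by move=> s; exact: (@invgK (tsg_type H)). Qed.

Lemma act_inv_eq (s : borel H) j a : (act (inv_borel s) j = a) <-> (act s a = j).
Proof. by split=> <-; rewrite ?act_Kinv ?act_invK. Qed.

Lemma adj_swapK i : involutive (adj_swap i).
Proof. by move=> j; rewrite /adj_swap; do !case: eqP => //; lia. Qed.

Lemma right_translK i : involutive (@right_transl H i).
Proof. by move=> s; apply: act_inj => j; rewrite !act_right adj_swapK. Qed.

Lemma left_translK i : involutive (@left_transl H i).
Proof. by move=> s; apply: act_inj => j; rewrite !act_left adj_swapK. Qed.

Lemma measurable_right i : measurable_fun setT (@right_transl H i).
Proof. by apply: measurable_into => j a; exact: measurable_eval. Qed.

Lemma measurable_left i : measurable_fun setT (@left_transl H i).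
Proof.
apply: measurable_into => j a.
rewrite (_ : [set _ | _] = [set s : borel H | act s j = adj_swap i a]).
  exact: measurable_eval.
apply/seteqP; split=> s /=; rewrite act_left; [move=> <-|move=> ->]; rewrite adj_swapK //.
Qed.

Lemma measurable_inv : measurable_fun setT inv_borel.
Proof.
apply: measurable_into => j a.
rewrite (_ : [set _ | _] = [set s : borel H | act s a = j]).
  exact: measurable_eval.
by apply/seteqP; split=> s /= /act_inv_eq.
Qed.

Lemma left_transl_inv i (s : borel H) :
  inv_borel (left_transl i (inv_borel s)) = right_transl i s.
Proof.
apply: act_inj => j; apply/act_inv_eq.
by rewrite act_left act_right act_invK adj_swapK.
Qed.

Lemma right_transl_inv i (s : borel H) :
  inv_borel (right_transl i (inv_borel s)) = left_transl i s.
Proof. by rewrite -left_transl_inv !inv_borelK. Qed.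

Lemma right_left_transl i j (s : borel H) :
  right_transl i (left_transl j s) = left_transl j (right_transl i s).
Proof. by apply: act_inj. Qed.

End generation.

(** The pushforward as a bundled measure; the proof of measurability is not found by
    inference, hence the explicit instance. *)
Definition image_measure d d' (T1 : measurableType d) (T2 : measurableType d')
    (R : realFieldType) (mu : {measure set T1 -> \bar R}) (f : T1 -> T2)
    (mf : measurable_fun setT f) : {measure set T2 -> \bar R} :=
  measure_function_pushforward__canonical__measure_function_Measure mu mf.

(** * Exchangeability as a scaling rule on ascents *)

Section flip.
Context (R : realType) (q : R) (q_gt0 : 0 < q) (H : transp_subgroup).
Variables (mu : {measure set (borel H) -> \bar R}) (g : borel H -> borel H).
Variables (U : set (borel H)) (w : borel H -> R).
Hypotheses (gK : involutive g) (mg : measurable_fun setT g) (mU : measurable U).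
Hypothesis gU : forall s, U (g s) <-> ~ U s.
Hypothesis wE : forall s, w s = if s \in U then q else q^-1.

Let mpre A : measurable A -> measurable (g @^-1` A).
Proof. by move=> mA; rewrite -[X in measurable X]setTI; exact: mg. Qed.

Lemma flip_out : (forall A, measurable A -> A `<=` U ->
    mu (g @^-1` A) = (q%:E * mu A)%E) ->
  forall A, measurable A -> A `<=` ~` U -> mu (g @^-1` A) = (q^-1%:E * mu A)%E.
Proof.
move=> qA A mA AU; have mgA := mpre mA.
have := qA _ mgA; rewrite -comp_preimage.
have -> : (g \o g) @^-1` A = A by apply/seteqP; split=> s; rewrite /preimage /= gK.
move=> -> ; last by move=> s /= /AU nU; have := (gU (g s)).2 nU; rewrite gK.
by rewrite muleA -EFinM mulVf ?mul1e // gt_eqF.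
Qed.

(** Splitting a set along U, the density integrates to q on one part and to 1/q on the
    other; the rule on the complement of U is the rule on U read backwards through g.
    Mutual absolute continuity follows because both values of the density are positive. *)
Lemma flipP :
  (equivalent_measures (pushforward mu g) mu /\
   is_density (pushforward mu g) mu w) <->
  (forall A, measurable A -> A `<=` U -> mu (g @^-1` A) = (q%:E * mu A)%E).
Proof.
have wU A : measurable A -> A `<=` U ->
    (\int[mu]_(s in A) (w s)%:E = q%:E * mu A)%E.
  move=> mA AU; rewrite -integral_cst //; apply: eq_integral => s.
  by rewrite inE wE => /AU/mem_set ->.
have wnU A : measurable A -> A `<=` ~` U ->
    (\int[mu]_(s in A) (w s)%:E = q^-1%:E * mu A)%E.
  move=> mA AU; rewrite -integral_cst //; apply: eq_integral => s.
  by rewrite inE wE => /AU/= ?; rewrite memNset.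
split=> [[_ [mw dens]] A mA AU|qA]; first by rewrite -wU // -dens.
have qVA := flip_out qA.
have spl A : A = (A `&` U) `|` (A `&` ~` U) by rewrite -setIUr setUv setIT.
have mw : measurable_fun setT w.
  rewrite (_ : w = fun s => if s \in U then q else q^-1); last exact/funext.
  apply: measurable_fun_if => //; try exact: measurable_cst.
  by apply: (@measurable_fun_bool _ _ _ _ true); rewrite setTI (_ : _ @^-1` _ = U) //;
     apply/seteqP; split=> s /=; [exact: set_mem|exact: mem_set].
have w_ge0 s : 0 <= w s by rewrite wE; case: ifP; rewrite ?invr_ge0 ltW.
have disj A : [disjoint A `&` U & A `&` ~` U].
  by apply/eqP; rewrite -setIIr setICr setI0.
have mI A : measurable A -> measurable (A `&` U) /\ measurable (A `&` ~` U).
  by move=> mA; split; apply: measurableI => //; exact: measurableC.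
have dens A : measurable A -> mu (g @^-1` A) = (\int[mu]_(s in A) (w s)%:E)%E.
  move=> mA; have [m1 m2] := mI A mA.
  rewrite {2}(spl A) ge0_integral_setU //=; first last.
  - by move=> s _; rewrite lee_fin.
  - by apply/measurable_EFinP; apply: measurable_funS mw.
  rewrite wU // wnU // -qA // -qVA //.
  rewrite {1}(spl A) preimage_setU measureU //; try exact: mpre.
  by rewrite -preimage_setI -setIIr setICr setI0 preimage_set0.
split; last by split => // A mA; rewrite -dens.
have muE A : measurable A ->
    pushforward mu g A = (q%:E * mu (A `&` U) + q^-1%:E * mu (A `&` ~` U))%E.
  move=> mA; have [m1 m2] := mI A mA.
  rewrite /pushforward {1}(spl A) preimage_setU measureU //; try exact: mpre.
    by congr (_ + _)%E; [exact: qA | exact: qVA].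
  by rewrite -preimage_setI -setIIr setICr setI0 preimage_set0.
have q0 : (q%:E != 0)%E by rewrite eqe gt_eqF.
have qV0 : (q^-1%:E != 0)%E by rewrite eqe gt_eqF // invr_gt0.
split=> A A0 B mB BA; have [m1 m2] := mI B mB.
- rewrite muE // (A0 _ m1) ?(A0 _ m2) ?mule0 ?adde0 //;
    exact: subset_trans (@subIsetl _ _ _) BA.
- have := A0 _ mB BA; rewrite muE // => /eqP.
  rewrite padde_eq0; try by rewrite mule_ge0 // lee_fin ?invr_ge0 ltW.
  rewrite !mule_eq0 (negbTE q0) (negbTE qV0) /= => /andP[/eqP a /eqP b].
  rewrite (spl B) measureU //; last by rewrite -setIIr setICr setI0.
  by apply: etrans (congr2 (fun x y => x + y)%E a b) _; rewrite adde0.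
Qed.

End flip.

(** Sums over a countable type are written as series over the codes of its elements;
    numbers that code nothing have empty fibres. *)
Lemma pickle_fibre (S : Type) (I : countType) (h : S -> I) (k : nat) :
  [set x | choice.pickle (h x) = k] =
  if choice.pickle_inv k is Some i then [set x | h x = i] else set0.
Proof.
case uk : (choice.pickle_inv k) => [i|]; apply/seteqP; split=> x //= hx.
- by move: uk; rewrite -hx choice.pickleK_inv => -[].
- by rewrite hx; have := @choice.pickle_invK I k; rewrite uk.
- by move: uk; rewrite -hx choice.pickleK_inv.
Qed.

Lemma measure_fibres d (T : measurableType d) (R : realType) (I : countType)
    (mu : {measure set T -> \bar R}) (h : T -> I) (A : set T) :
  measurable A -> (forall i, measurable [set x | h x = i]) ->
  mu A = (\sum_(k <oo) mu (A `&` [set x | choice.pickle (h x) = k]))%E.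
Proof.
move=> mA mh.
have mk k : measurable [set x | choice.pickle (h x) = k].
  by rewrite pickle_fibre; case: choice.pickle_inv.
rewrite -measure_semi_bigcup; first last.
- by apply: bigcupT_measurable => k; exact: measurableI.
- by apply/trivIsetP => i j _ _ ij; apply/seteqP; split=> x //= [[_ hi] [_ hj]];
     move: ij; rewrite -hi -hj eqxx.
- by move=> k; exact: measurableI.
congr (mu _); apply/seteqP; split=> [x Ax|x [k _ []]] //.
by exists (choice.pickle (h x)).
Qed.

(** The form in which countable additivity is used: a scaling rule may be checked on
    the fibres of a map with countably many values. *)
Lemma measure_scale_fibres d1 d2 (T1 : measurableType d1) (T2 : measurableType d2)
    (R : realType) (I : countType)
    (mu : {measure set T1 -> \bar R}) (nu : {measure set T2 -> \bar R})
    (f : T1 -> I) (g : T2 -> I) (A : set T1) (B : set T2) (c : R) :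
  measurable A -> measurable B ->
  (forall i, measurable [set x | f x = i]) ->
  (forall i, measurable [set x | g x = i]) ->
  (forall i, nu (B `&` [set x | g x = i]) = c%:E * mu (A `&` [set x | f x = i]))%E ->
  (nu B = c%:E * mu A)%E.
Proof.
move=> mA mB mf mg fg.
rewrite (measure_fibres nu mB mg) (measure_fibres mu mA mf) -nneseriesZl //.
apply: eq_eseriesr => k _; rewrite !pickle_fibre.
by case: choice.pickle_inv => [i|]; [exact: fg | rewrite !setI0 !measure0 mule0].
Qed.

Section exch.
Context (R : realType) (q : R) (q_gt0 : 0 < q) (H : transp_subgroup).
Implicit Types (mu : {measure set (borel H) -> \bar R}) (s : borel H).

Definition pos_ascent i : set (borel H) := [set s | act s i < act s (i + 1)].
Definition val_ascent i : set (borel H) :=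
  [set s | act (inv_borel s) i < act (inv_borel s) (i + 1)].

Lemma act_injective s : injective (act s).
Proof. exact: can_inj (act_invK s). Qed.

(** Injectivity excludes the value 0 of the sign, so the weight takes only the values
    q and 1/q. *)
Lemma sg_weight (x y : int) : x <> y ->
  q ^ Num.sg (y - x) = if x < y then q else q^-1.
Proof.
move=> xy; case: ltgtP xy => // xy _.
  by rewrite gtr0_sg ?subr_gt0 // expr1z.
by rewrite ltr0_sg ?subr_lt0 // exprN1.
Qed.

Lemma right_exchP mu : right_q_exchangeable q mu <->
  (forall i A, measurable A -> A `<=` pos_ascent i ->
     mu (right_transl i @^-1` A) = (q%:E * mu A)%E).
Proof.
have F i := @flipP R q q_gt0 H mu (right_transl i) (pos_ascent i)
  (right_weight q i) (@right_translK H i) (@measurable_right H i).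
have mP i : measurable (pos_ascent i) by exact: (measurable_rel <%R).
have ne s i : act s i <> act s (i + 1) by move=> /act_injective; lia.
have gU i s : pos_ascent i (right_transl i s) <-> ~ pos_ascent i s.
  rewrite /pos_ascent /= !act_right /adj_swap eqxx.
  rewrite (_ : (i + 1 == i) = false); last by lia.
  by rewrite eqxx; have := ne s i; lia.
have wE i s : right_weight q i s = if s \in pos_ascent i then q else q^-1.
  rewrite /right_weight sg_weight; last exact: ne.
  by congr (if _ then _ else _); apply/idP/idP; rewrite inE.
by split=> h i; apply/(F i (mP i) (gU i) (wE i)); exact: h.
Qed.

Lemma left_exchP mu : left_q_exchangeable q mu <->
  (forall i A, measurable A -> A `<=` val_ascent i ->
     mu (left_transl i @^-1` A) = (q%:E * mu A)%E).
Proof.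
have F i := @flipP R q q_gt0 H mu (left_transl i) (val_ascent i)
  (left_weight q i) (@left_translK H i) (@measurable_left H i).
have mP i : measurable (val_ascent i).
  rewrite -[X in measurable X]setTI.
  apply: (@measurable_inv H _ [set s | act s i < act s (i + 1)]) => //.
  exact: (measurable_rel <%R).
have ne s i : act s i <> act s (i + 1) by move=> /act_injective; lia.
have gU i s : val_ascent i (left_transl i s) <-> ~ val_ascent i s.
  rewrite /val_ascent /= (_ : inv_borel (left_transl i s) =
    right_transl i (inv_borel s)); last by rewrite -left_transl_inv inv_borelK.
  rewrite !act_right /adj_swap eqxx.
  rewrite (_ : (i + 1 == i) = false); last by lia.
  by rewrite eqxx; have := ne (inv_borel s) i; lia.
have wE i s : left_weight q i s = if s \in val_ascent i then q else q^-1.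
  rewrite /left_weight sg_weight; last exact: (ne (inv_borel s)).
  by congr (if _ then _ else _); apply/idP/idP; rewrite inE.
by split=> h i; apply/(F i (mP i) (gU i) (wE i)); exact: h.
Qed.

Lemma right_exch_descent mu : right_q_exchangeable q mu ->
  forall i A, measurable A -> A `<=` ~` pos_ascent i ->
    mu (right_transl i @^-1` A) = (q^-1%:E * mu A)%E.
Proof.
move=> /right_exchP E i A mA AU.
apply: (@flip_out R q q_gt0 H mu (right_transl i) (pos_ascent i)) => //.
- exact: right_translK.
- exact: measurable_right.
- move=> s; rewrite /pos_ascent /= !act_right /adj_swap eqxx.
  rewrite (_ : (i + 1 == i) = false); last by lia.
  by rewrite eqxx; have := @act_injective s i (i + 1); lia.
- exact: E.
Qed.

End exch.

(** * Equivalence of right and left exchangeability *)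

Section right_to_left.
Context (R : realType) (q : R) (q_gt0 : 0 < q) (H : transp_subgroup).
Implicit Types (mu : {measure set (borel H) -> \bar R}) (s : borel H).

Lemma measurable_preright i (A : set (borel H)) :
  measurable A -> measurable (right_transl i @^-1` A).
Proof. by move=> mA; rewrite -[X in measurable X]setTI; exact: measurable_right. Qed.

Lemma measurable_preleft i (A : set (borel H)) :
  measurable A -> measurable (left_transl i @^-1` A).
Proof. by move=> mA; rewrite -[X in measurable X]setTI; exact: measurable_left. Qed.

Lemma mule_injl (c : R) : 0 < c -> injective (fun x : \bar R => c%:E * x)%E.
Proof.
move=> c0 x y /(congr1 (fun z => (c^-1)%:E * z)%E).
by rewrite !muleA -!EFinM mulVf ?gt_eqF // !mul1e.
Qed.

(** If i and i+1 occupy adjacent positions, exchanging the values is the same as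
    exchanging the positions. *)
Lemma left_right_transl (i a : int) s :
  act s a = i /\ act s (a + 1) = i + 1 \/ act s a = i + 1 /\ act s (a + 1) = i ->
  left_transl i s = right_transl a s.
Proof.
move=> sa; apply: act_inj => j; rewrite act_left act_right /adj_swap.
case: (j =P a) => [->|ja].
  by case: sa => -[-> ->]; rewrite ?eqxx //; case: eqP => //; lia.
case: (j =P a + 1) => [->|ja1].
  by case: sa => -[-> ->]; rewrite ?eqxx //; case: eqP => //; lia.
have n1 : act s j <> act s a by move=> /act_injective.
have n2 : act s j <> act s (a + 1) by move=> /act_injective.
by case: sa => -[sa sb]; rewrite sa sb in n1 n2; do 2 case: eqP => //.
Qed.

(** Induction on the distance n between the positions of i and i+1.  Let b be the
    position just before that of i+1.  Exchanging positions b and b+1 brings i+1 one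
    step closer to i and commutes with the exchange of values.  The entry at b is neither i
    nor i+1, so it compares in the same way with both, and the factor paid for the swap
    of positions before the exchange of values is recovered after it. *)
Lemma left_transl_adjacent mu (i a : int) (n : nat) (A : set (borel H)) :
  right_q_exchangeable q mu -> measurable A ->
  (forall s, A s -> act s a = i /\ act s (a + n.+1%:Z) = i + 1) ->
  mu (left_transl i @^-1` A) = (q%:E * mu A)%E.
Proof.
move=> qmu; elim: n A => [|n IHn] A mA Aab.
  have -> : left_transl i @^-1` A = right_transl a @^-1` A.
    apply/seteqP; split=> s /= As; have [] := Aab _ As.
      rewrite !act_left => sa sb; rewrite -(left_right_transl (i := i)) //; right.
      by rewrite -(adj_swapK i (act s a)) sa -(adj_swapK i (act s _)) sb /adj_swap;
         split; case: eqP => //; case: eqP => //; lia.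
    rewrite !act_right /adj_swap eqxx (_ : a + 1 == a = false); last by lia.
    by rewrite eqxx => sa sb; rewrite (left_right_transl (a := a)) //; right.
  apply: (right_exchP q_gt0 mu).1 => // s /Aab[sa]; rewrite /pos_ascent /= sa.
  by move=> ->; lia.
pose b := a + n.+1%:Z; pose r := @right_transl H b.
have E s : A s -> [/\ act s a = i, act s b <> i, act s b <> i + 1
                    & act s (b + 1) = i + 1].
  move=> As; have [sa sb] := Aab _ As.
  have -> : b + 1 = a + n.+2%:Z by rewrite /b; lia.
  by split=> //; [rewrite -sa|rewrite -sb] => /act_injective; rewrite /b; lia.
have IH B : measurable B -> B `<=` A -> 
    mu (r @^-1` (left_transl i @^-1` B)) = (q%:E * mu (r @^-1` B))%E.
  move=> mB BA; rewrite -IHn; first by congr (mu _); apply/seteqP; split=> s; rewrite /preimage /= /r right_left_transl.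
    exact: measurable_preright.
  move=> s /= /BA /E[]; rewrite !act_right /adj_swap eqxx.
  rewrite (_ : a == b = false); last by rewrite /b; lia.
  rewrite (_ : a == b + 1 = false); last by rewrite /b; lia.
  rewrite (_ : b + 1 == b = false); last by lia.
  by rewrite eqxx.
(* The entry at b is below i on A1 and above i + 1 on A2. *)
pose A1 := A `&` pos_ascent b; pose A2 := A `&` ~` pos_ascent b.
have mP : measurable (@pos_ascent H b) by exact: (measurable_rel <%R).
have mA1 : measurable A1 by exact: measurableI.
have mA2 : measurable A2 by apply: measurableI => //; exact: measurableC.
have Q1 : mu (left_transl i @^-1` A1) = (q%:E * mu A1)%E.
  have := IH A1 mA1 (@subIsetl _ _ _).
  rewrite (right_exchP q_gt0 mu).1 //; first last.
  - move=> s [/E[sa sb1 sb2 sb3]]; move: sa sb1 sb2 sb3; rewrite /pos_ascent /=.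
    rewrite !act_left /adj_swap.
    by rewrite -?[b + 1]/(b + 1); do !case: eqP => //; lia.
  - exact: measurable_preleft.
  rewrite (right_exchP q_gt0 mu).1 //; last by move=> s [].
  exact: mule_injl.
have Q2 : mu (left_transl i @^-1` A2) = (q%:E * mu A2)%E.
  have := IH A2 mA2 (@subIsetl _ _ _).
  rewrite (right_exch_descent q_gt0) //; first last.
  - move=> s [/E[sa sb1 sb2 sb3]]; move: sa sb1 sb2 sb3; rewrite /pos_ascent /=.
    rewrite !act_left /adj_swap.
    by rewrite -?[b + 1]/(b + 1); do !case: eqP => //; lia.
  - exact: measurable_preleft.
  rewrite (right_exch_descent q_gt0) //; last by move=> s [].
  by rewrite muleCA; apply: (@mule_injl q^-1); rewrite invr_gt0.
have spl : A = A1 `|` A2 by rewrite -setIUr setUv setIT.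
have disj : A1 `&` A2 = set0 by rewrite -setIIr setICr setI0.
rewrite spl preimage_setU measureU ?[X in (q%:E * X)%E]measureU //.
- rewrite ge0_muleDr //; by congr (_ + _)%E.
- exact: measurable_preleft.
- exact: measurable_preleft.
- by rewrite -preimage_setI disj preimage_set0.
Qed.

(** Decompose along the positions of i and i+1. *)
Lemma right_to_left mu : right_q_exchangeable q mu -> left_q_exchangeable q mu.
Proof.
move=> qmu; apply/(left_exchP q_gt0) => i A mA Ai.
pose f s : int * int := (act (inv_borel s) i, act (inv_borel s) (i + 1)).
have mf c : measurable [set s | f s = c].
  rewrite (_ : [set _ | _] = [set s : borel H | act s c.1 = i] `&`
                             [set s : borel H | act s c.2 = i + 1]).
    by apply: measurableI; exact: measurable_eval.
  apply/seteqP; split=> s /=; rewrite /f; case: c => a b /=.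
    by move=> [/act_inv_eq ? /act_inv_eq ?].
  by move=> [/act_inv_eq -> /act_inv_eq ->].
apply: (@measure_scale_fibres _ _ _ _ _ _ _ _ f (fun s => f (left_transl i s))) => //.
- exact: measurable_preleft.
- by move=> c; exact: (measurable_preleft i (mf c)).
move=> [a b].
pose B := A `&` [set s | f s = (a, b)].
have mB : measurable B by exact: measurableI.
case: (ltP a b) => ab; last first.
  suff B0 : B = set0.
    rewrite (_ : _ `&` _ = left_transl i @^-1` B) //.
    by rewrite -/B B0 preimage_set0 !measure0 mule0.
  apply/seteqP; split=> s // [/Ai]; rewrite /val_ascent /= => + [sa sb].
  by rewrite sa sb; lia.
change (mu (left_transl i @^-1` B) = (q%:E * mu B)%E).
apply: (@left_transl_adjacent mu i a (absz (b - a - 1)%R) B qmu mB) => s [As [sa sb]].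
have -> : a + (absz (b - a - 1)%R).+1%:Z = b by lia.
by split; apply/act_inv_eq.
Qed.

End right_to_left.

Section left_to_right.
Context (R : realType) (q : R) (q_gt0 : 0 < q) (H : transp_subgroup).
Implicit Types (mu : {measure set (borel H) -> \bar R}) (s : borel H).

Definition inverse_law mu : {measure set (borel H) -> \bar R} :=
  image_measure mu (@measurable_inv H).

Lemma measurable_preinv (A : set (borel H)) :
  measurable A -> measurable (@inv_borel H @^-1` A).
Proof. by move=> mA; rewrite -[X in measurable X]setTI; exact: measurable_inv. Qed.

Lemma preinvK (A : set (borel H)) : @inv_borel H @^-1` (@inv_borel H @^-1` A) = A.
Proof. by apply/seteqP; split=> s; rewrite /preimage /= inv_borelK. Qed.

(** Inversion conjugates left translations to right ones and ascents of values to ascents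
    of positions. *)
Lemma left_right_inverse mu (nu : {measure set (borel H) -> \bar R}) :
  (forall A, measurable A -> nu A = mu (@inv_borel H @^-1` A)) ->
  left_q_exchangeable q mu -> right_q_exchangeable q nu.
Proof.
move=> nuE /(left_exchP q_gt0) qmu; apply/(right_exchP q_gt0) => i A mA Ai.
rewrite !nuE //; last exact: measurable_preright.
rewrite -(qmu i _ (measurable_preinv mA)); last by move=> s /Ai.
congr (mu _); apply/seteqP; split=> s; rewrite /preimage /=;
  by rewrite -right_transl_inv inv_borelK.
Qed.

Lemma right_iff_left mu : right_q_exchangeable q mu <-> left_q_exchangeable q mu.
Proof.
split; first exact: right_to_left.
move=> qmu; have qnu : right_q_exchangeable q (inverse_law mu).
  exact: left_right_inverse qmu.
apply: left_right_inverse (right_to_left q_gt0 qnu) => A mA.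
by rewrite -{1}(preinvK A).
Qed.

End left_to_right.

(** * Geometric digits of a uniform number *)

Section digits.
Context (R : realType) (q : R) (q_gt0 : 0 < q) (q_lt1 : q < 1).

(** The powers of q are the end points of the partition below, which must exhaust ]0,1]. *)
Lemma expr_small (e : R) : 0 < e -> exists n : nat, q ^+ n < e.
Proof.
move=> e0; have q1 : `|q| < 1 by rewrite gtr0_norm.
have /cvgrPdist_lt /(_ e e0)[n _ /(_ n (leqnn n))] := cvg_expr q1.
by rewrite sub0r normrN ger0_norm ?exprn_ge0 1?ltW // => h; exists n.
Qed.

(** The intervals ]q^(k+1), q^k] partition ]0,1] into pieces of lengths (1-q) q^k, so that
    the index of the piece of a uniform number is a geometric variable. *)
Definition digit (x : R) : nat := xget 0%N [set k : nat | q ^+ k.+1 < x <= q ^+ k].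

Lemma digitP x k : 0 < x <= 1 -> digit x = k <-> q ^+ k.+1 < x <= q ^+ k.
Proof.
move=> /andP[x0 x1].
have uniq_k a b : q ^+ a.+1 < x <= q ^+ a -> q ^+ b.+1 < x <= q ^+ b -> (a <= b)%N.
  move=> /andP[_ a2] /andP[b1 _]; rewrite leqNgt; apply/negP => ba.
  have : x < x; last by rewrite ltxx.
  apply: le_lt_trans a2 _; apply: le_lt_trans b1.
  by rewrite ler_iXn2l // ltW.
have [k0 hk0] : exists k, q ^+ k.+1 < x <= q ^+ k.
  have ex : exists k, q ^+ k < x by exact: expr_small.
  case: (ex_minnP ex) => -[|n] qn nmin; first by move: qn; rewrite expr0 ltNge x1.
  exists n; rewrite qn leNgt; apply/negP => /nmin; lia.
have D : [set k : nat | q ^+ k.+1 < x <= q ^+ k] (digit x).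
  by apply: xgetPex; exists k0.
by split=> [<- //|hk]; apply/eqP; rewrite eqn_leq !uniq_k.
Qed.

(** The rescaled position of x inside its piece, again uniform and independent of the digit. *)
Definition shift (x : R) : R := (x / q ^+ digit x - q) / (1 - q).
Definition unshift (k : nat) (t : R) : R := q ^+ k * (q + (1 - q) * t).
Definition digits (x : R) (n : nat) : nat := digit (iter n shift x).

(** Composition of the affine maps that carry ]0,1] onto the pieces with the first n
    indices f; its image is the set of numbers with those first digits. *)
Fixpoint affine (n : nat) (f : nat -> nat) (t : R) : R :=
  if n is n'.+1 then unshift (f 0) (affine n' (f \o S) t) else t.

Lemma unshift_le k : {mono unshift k : x y / x <= y}.
Proof.
move=> x y; rewrite /unshift ler_pM2l ?exprn_gt0 // lerD2l ler_pM2l //.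
by rewrite subr_gt0.
Qed.

Lemma unshiftK x : 0 < x <= 1 -> unshift (digit x) (shift x) = x.
Proof.
move=> x01; rewrite /unshift /shift.
have : q ^+ digit x != 0 by rewrite gt_eqF // exprn_gt0.
have : 1 - q != 0 by rewrite gt_eqF // subr_gt0.
by move: (q ^+ digit x) => a ? ?; field; apply/andP.
Qed.

Lemma unshift_itv k t : (q ^+ k.+1 < unshift k t <= q ^+ k) = (0 < t <= 1).
Proof.
have -> : q ^+ k.+1 = unshift k 0 by rewrite /unshift mulr0 addr0 exprSr.
have E1 : q ^+ k = unshift k 1 by rewrite /unshift mulr1 addrC subrK mulr1.
by rewrite E1 unshift_le (leW_mono (unshift_le _)).
Qed.

Lemma shift_unit x : 0 < x <= 1 -> 0 < shift x <= 1.
Proof.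
move=> x01; have := (digitP (digit x) x01).1 erefl; have := unshiftK x01.
by move: (digit x) (shift x) => k t <-; rewrite unshift_itv.
Qed.

Lemma combo_unit t : 0 <= t <= 1 -> 0 <= q + (1 - q) * t <= 1.
Proof. move=> /andP[t0 t1]; have := q_gt0; have := q_lt1 => *; apply/andP; split; nra. Qed.

Lemma affine_unit n f t : 0 <= t <= 1 -> 0 <= affine n f t <= 1.
Proof.
elim: n f => //= n IHn f t01; have /andP[h0 h1] := combo_unit (IHn (f \o S) t01).
have qf : 0 <= q ^+ f 0%N by rewrite exprn_ge0 // ltW.
by apply/andP; split; [exact: mulr_ge0|apply: mulr_ile1 => //; rewrite exprn_ile1 // ltW].
Qed.

Let le01 : 0 <= (0 : R) <= 1. Proof. by rewrite lexx ler01. Qed.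
Let le11 : 0 <= (1 : R) <= 1. Proof. by rewrite lexx ler01. Qed.

Lemma digits_affine n f x : 0 < x <= 1 ->
  (forall k, (k < n)%N -> digits x k = f k) <-> affine n f 0 < x <= affine n f 1.
Proof.
elim: n f x => [|n IHn] f x x01; first by split.
have S01 := shift_unit x01.
have E : (forall k, (k < n.+1)%N -> digits x k = f k) <->
   digit x = f 0%N /\ (forall k, (k < n)%N -> digits (shift x) k = (f \o S) k).
  split=> [h|[h0 h] [|k] //].
    by split=> [|k kn /=]; [exact: (h 0%N)|rewrite -h // /digits -iterSr].
  by move=> kn; rewrite -[RHS]h // /digits -iterSr.
rewrite E IHn //=; split.
  move=> [<-]; have := unshiftK x01; move: (digit x) (shift x) => k t <-.
  by rewrite unshift_le (leW_mono (unshift_le _)).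
move=> h; have d0 : digit x = f 0%N.
  apply/digitP => //; move: h => /andP[h1 h2]; apply/andP; split.
    apply: le_lt_trans h1; rewrite /unshift exprSr ler_pM2l ?exprn_gt0 //.
    have /andP[a0 _] := affine_unit n (f \o S) le01.
    by rewrite lerDl mulr_ge0 // subr_ge0 ltW.
  have /andP[_ a1] := combo_unit (affine_unit n (f \o S) le11).
  apply: le_trans h2 _; rewrite /unshift -[leRHS]mulr1 ler_pM2l ?exprn_gt0 //.
split=> //; move: h; rewrite -d0; have := unshiftK x01.
move: (digit x) (shift x) => k t <-.
by rewrite unshift_le (leW_mono (unshift_le _)).
Qed.

Lemma affine_length n f :
  affine n f 1 - affine n f 0 = \prod_(k < n) ((1 - q) * q ^+ f k).
Proof.
elim: n f => [|n IHn] f; first by rewrite big_ord0 /= subr0.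
rewrite big_ord_recl /= -(IHn (f \o S)) /unshift; ring.
Qed.

End digits.

Definition determined (n : nat) (G : (nat -> nat) -> Prop) :=
  forall f g : nat -> nat, (forall k, (k < n)%N -> f k = g k) -> G f -> G g.

Section digit_law.
Context (R : realType) (q : R) (q_gt0 : 0 < q) (q_lt1 : q < 1).
Local Notation D := (measurableTypeR R).

(** Digits are set to 0 outside ]0,1], where the reference measure vanishes, so that all
    sets below are measurable subsets of the whole line. *)
Definition unit_digits (x : D) (k : nat) : nat :=
  if 0 < x <= 1 then digits q x k else 0%N.
Local Notation dg := unit_digits.

Definition leb01 : {measure set D -> \bar R} :=
  mrestr (@lebesgue_measure R) (measurable_itv (`]0%R, 1%R] : interval R)).

Lemma leb01T : leb01 setT = 1%E.
Proof.
rewrite /leb01 /= /mrestr setTI.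
by rewrite lebesgue_measure_itv /= lte_fin ltr01 oppr0 adde0.
Qed.

Let prefix n (f : nat -> nat) : set D := [set x | forall k, (k < n)%N -> dg x k = f k].

(** The set of numbers with given first digits is an interval, whose length is the
    product of the geometric weights. *)
Lemma prefix_unit n f :
  prefix n f `&` `]0, 1]%classic = `](affine q n f 0), (affine q n f 1)]%classic.
Proof.
apply/seteqP; split=> x /=; rewrite !in_itv /=.
  move=> [px x01]; apply/(digits_affine q_gt0 q_lt1 n f x01) => k kn.
  by have := px k kn; rewrite /dg x01.
have /andP[a0 a1] : 0 <= affine q n f 0 <= 1 by rewrite affine_unit // lexx ler01.
have /andP[b0 b1] : 0 <= affine q n f 1 <= 1 by rewrite affine_unit // lexx ler01.
move=> /[dup] fx /andP[x0 x1]; have x01 : 0 < x <= 1.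
  by rewrite (le_lt_trans a0 x0) (le_trans x1 b1).
split=> // k kn; rewrite /dg x01.
by apply: (digits_affine q_gt0 q_lt1 n f x01).2.
Qed.

Lemma measurable_prefix n f : measurable (prefix n f).
Proof.
have -> : prefix n f = (prefix n f `&` `]0, 1]%classic) `|`
                       (prefix n f `&` ~` `]0, 1]%classic).
  by rewrite -setIUr setUv setIT.
apply: measurableU; first by rewrite prefix_unit; exact: measurable_itv.
case: (pselect (forall k, (k < n)%N -> f k = 0%N)) => f0.
  rewrite (_ : _ `&` _ = ~` `]0, 1]%classic); first by apply: measurableC; exact: measurable_itv.
  apply/seteqP; split=> x; first by case.
  move=> nx; split=> // k kn; rewrite f0 // /dg.
  by case: ifP => // x01; exfalso; apply: nx; rewrite /= in_itv.
rewrite (_ : _ `&` _ = set0) //; apply/seteqP; split=> x // -[px nx].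
apply: f0 => k kn; rewrite -(px k kn) /dg.
by case: ifP => // x01; exfalso; apply: nx; rewrite /= in_itv.
Qed.

Lemma leb01_prefix n f :
  leb01 (prefix n f) = (\prod_(k < n) ((1 - q) * q ^+ f k))%:E.
Proof.
have L := affine_length q n f.
have P : 0 < \prod_(k < n) ((1 - q) * q ^+ f k).
  by rewrite prodr_gt0 // => k _; rewrite mulr_gt0 ?subr_gt0 ?exprn_gt0.
rewrite /leb01 /= /mrestr prefix_unit lebesgue_measure_itv /= lte_fin.
by rewrite -subr_gt0 L P -L EFinB.
Qed.

Lemma measurable_determined n G : determined n G -> measurable [set x | G (dg x)].
Proof.
move=> dG; rewrite (_ : [set _ | _] = \bigcup_(l : seq nat)
   (if `[< G (nth 0%N l) >] then prefix n (nth 0%N l) else set0)).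
  apply: countable_bigcupT_measurable => [|l]; first exact: countableP.
  by case: ifP => _ //; exact: measurable_prefix.
apply/seteqP; split=> x /=.
  have E k : (k < n)%N -> dg x k = nth 0%N (mkseq (dg x) n) k.
    by move=> kn; rewrite nth_mkseq.
  move=> Gx; exists (mkseq (dg x) n) => //; rewrite ifT //.
  by apply/asboolP; apply: dG Gx.
move=> [l _]; case: ifP => // /asboolP Gl xl; apply: dG Gl => k kn.
by rewrite xl.
Qed.

(** Independence of the n-th digit from the previous ones: on each of the countably many
    prefixes allowed by G it is the formula for the length of an interval. *)
Lemma leb01_next n G v : determined n G ->
  (leb01 [set x | G (dg x) /\ dg x n = v] =
   ((1 - q) * q ^+ v)%:E * leb01 [set x | G (dg x)])%E.
Proof.
move=> dG; pose f (x : D) := mkseq (dg x) n.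
have mG := measurable_determined dG.
have dG' : determined n.+1 (fun d => G d /\ d n = v).
  by move=> a b ab [Ga an]; split; [apply: dG Ga => k kn; apply: ab; lia|rewrite -ab].
have mf l : measurable [set x | f x = l].
  have : determined n (fun d => mkseq d n = l).
    move=> a b ab <-; apply/eq_in_map => k; rewrite mem_iota => kn.
    by rewrite ab //; lia.
  by move/measurable_determined.
apply: (@measure_scale_fibres _ _ _ _ _ _ _ _ f f) => //.
  exact: measurable_determined dG'.
move=> l; case: (pselect (size l = n /\ G (nth 0%N l))) => [[sl Gl]|nl].
  rewrite (_ : _ `&` _ = prefix n.+1 (fun k => if (k < n)%N then nth 0%N l k else v)).
    rewrite [X in (_ = _ * leb01 X)%E](_ : _ = prefix n (nth 0%N l)).
      rewrite !leb01_prefix -EFinM big_ord_recr /= ltnn mulrC; congr EFin; congr (_ * _).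
      by apply: eq_bigr => k _; rewrite ltn_ord.
    apply/seteqP; split=> x /=.
      by move=> [_ <-] k kn; rewrite nth_mkseq.
    move=> xl; split; first by apply: dG Gl => k kn; rewrite xl.
    apply: (@eq_from_nth _ 0%N); first by rewrite size_mkseq.
    by move=> k; rewrite size_mkseq => kn; rewrite nth_mkseq // xl.
  apply/seteqP; split=> x /=.
    move=> [[_ xv] <-] k; rewrite ltnS leq_eqVlt => /orP[/eqP ->|kn].
      by rewrite ltnn.
    by rewrite kn nth_mkseq.
  move=> xl; split; first split.
  - by apply: dG Gl => k kn; rewrite xl ?kn //; lia.
  - by rewrite xl // ltnn.
  apply: (@eq_from_nth _ 0%N); first by rewrite size_mkseq.
  by move=> k; rewrite size_mkseq => kn; rewrite nth_mkseq // xl ?kn //; lia.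
have E (B : set D) : B `<=` [set x | G (dg x)] -> B `&` [set x | f x = l] = set0.
  move=> BG; apply/seteqP; split=> x //= [/BG/= Gx fx]; apply: nl; split.
    by rewrite -fx size_mkseq.
  by apply: dG Gx => k kn; rewrite -fx nth_mkseq.
by rewrite !E ?measure0 ?mule0 // => x [].
Qed.

(** Avoiding the digit 0 at M prescribed places has probability q^M.  The places form an
    arithmetic progression of step 2 because the even and the odd digits build separate
    permutations. *)
Lemma leb01_no_zero (N b : nat) :
  leb01 [set x | forall k, dg x (2 * (N + k) + b)%N <> 0%N] = 0%E.
Proof.
pose G M (d : nat -> nat) := forall k, (k < M)%N -> d (2 * (N + k) + b)%N <> 0%N.
have dG M : determined (2 * (N + M) + b) (G M).
  by move=> f g fg Gf k kM; rewrite -fg; [exact: Gf|lia].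
have mG M := measurable_determined (dG M).
have LG M : leb01 [set x | G M (dg x)] = (q ^+ M)%:E.
  elim: M => [|M IHM].
    rewrite expr0 -leb01T; congr (leb01 _).
    by apply/seteqP; split=> x //= _ k.
  have := leb01_next 0 (dG M); rewrite IHM expr0 mulr1 -EFinM => E0.
  have spl : [set x | G M (dg x)] = [set x | G M.+1 (dg x)] `|`
      [set x | G M (dg x) /\ dg x (2 * (N + M) + b)%N = 0%N].
    apply/seteqP; split=> x /=.
      move=> Gx; case: (eqVneq (dg x (2 * (N + M) + b)%N) 0%N) => [x0|/eqP x0].
        by right.
      left=> k; rewrite ltnS leq_eqVlt => /orP[/eqP -> //|]; exact: Gx.
    by move=> [Gx k kM|[]] //; apply: Gx; lia.
  have m0 : measurable [set x | G M (dg x) /\ dg x (2 * (N + M) + b)%N = 0%N].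
    apply: (@measurable_determined (2 * (N + M) + b).+1
       (fun d => G M d /\ d (2 * (N + M) + b)%N = 0%N)).
    by move=> f g fg [Gf f0]; split; [apply: dG Gf => k kM; apply: fg; lia|rewrite -fg].
  have e : (leb01 [set x | G M.+1 (dg x)] + ((1 - q) * q ^+ M)%:E = (q ^+ M)%:E)%E.
    rewrite -E0 -IHM spl measureU //.
    apply/seteqP; split=> x //= [Gx [_ x0]]; exact: (Gx M (ltnSn M)).
  have fin : leb01 [set x | G M.+1 (dg x)] \is a fin_num.
    rewrite ge0_fin_numE ?measure_ge0 //; apply: le_lt_trans (ltry (q ^+ M)).
    by rewrite -e leeDl // lee_fin mulr_ge0 ?exprn_ge0 1?ltW // subr_gt0.
  move: e; rewrite -(fineK fin) -EFinD => -[] e; congr EFin.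
  by rewrite exprS; move: e; move: (fine _) (q ^+ M) => a c; lra.
apply/eqP; rewrite eq_le measure_ge0 andbT; apply/lee_addgt0Pr => e e0.
have [M qM] := expr_small q_gt0 q_lt1 e0.
rewrite add0e; apply: le_trans (_ : leb01 [set x | G M (dg x)] <= _)%E; last first.
  by rewrite LG lee_fin ltW.
apply: le_measure; rewrite ?inE //; last by move=> x /= h k _.
rewrite (_ : [set _ | _] = \bigcap_(M in [set: nat]) [set x | G M (dg x)]).
  by apply: bigcap_measurableType => // K _.
apply/seteqP; split=> x /=; first by move=> h K _ k _.
by move=> h k; apply: (h k.+1 I k).
Qed.

End digit_law.

(** * Permutations of the naturals coded by ranks *)

Section picks.
Local Open Scope nat_scope.

Definition rank (l : seq nat) (x : nat) : nat := count (fun y => y \notin l) (iota 0 x).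

Lemma rankS l x : rank l x.+1 = rank l x + (x \notin l).
Proof. by rewrite /rank -addn1 iotaD count_cat /= addn0. Qed.

Lemma rank_le l x y : x <= y -> rank l x <= rank l y.
Proof. by move=> xy; rewrite /rank -(subnKC xy) iotaD count_cat leq_addr. Qed.

Lemma rank_unbounded l v : exists x, v < rank l x.+1.
Proof.
exists (size l + v).
have := count_predC (fun y => y \in l) (iota 0 (size l + v).+1).
rewrite size_iota -/(rank _ _) => E.
suff : count (fun y => y \in l) (iota 0 (size l + v).+1) <= size l.
  by move: E; rewrite /rank; set a := count _ _; set b := count _ _; lia.
rewrite -size_filter; apply: uniq_leq_size; first by rewrite filter_uniq // iota_uniq.
by move=> y; rewrite mem_filter => /andP[].
Qed.

Definition missing (l : seq nat) (v : nat) : nat :=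
  xget 0 [set x | x \notin l /\ rank l x = v].

(** The rank grows by one at each value outside l and is constant elsewhere, so it takes
    each value v exactly once outside l. *)
Lemma missingP l v x : missing l v = x <-> x \notin l /\ rank l x = v.
Proof.
have uniq_x a b : a \notin l /\ rank l a = v -> b \notin l /\ rank l b = v -> a <= b.
  move=> [al av] [bl bv]; rewrite leqNgt; apply/negP => ba.
  have := @rank_le l b.+1 a ba; rewrite rankS bl; lia.
have M : [set x | x \notin l /\ rank l x = v] (missing l v).
  apply: xgetPex; have ex := rank_unbounded l v.
  case: (ex_minnP ex) => y; rewrite rankS => vy ymin.
  have yv : rank l y <= v.
    case: y vy ymin => // y _ ymin; rewrite leqNgt; apply/negP => /ymin; lia.
  by exists y => /=; move: vy; case: (y \notin l); lia.
by split=> [<- //|hx]; apply/eqP; rewrite eqn_leq !uniq_x.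
Qed.

Fixpoint picks (d : nat -> nat) (n : nat) : seq nat :=
  if n is n'.+1 then rcons (picks d n') (missing (picks d n') (d n')) else [::].

(** The permutation coded by the digits d, as in a Lehmer code: the n-th value is the
    one of rank d n among those not yet used. *)
Definition value (d : nat -> nat) (n : nat) : nat := missing (picks d n) (d n).

Lemma picksE d n : picks d n = mkseq (value d) n.
Proof. by elim: n => // n IHn; rewrite mkseqS -IHn. Qed.

Lemma valueP d n x :
  value d n = x <-> x \notin mkseq (value d) n /\ rank (mkseq (value d) n) x = d n.
Proof. by rewrite -picksE; exact: missingP. Qed.

Lemma value_inj d : injective (value d).
Proof.
have key a b : a < b -> value d a <> value d b.
  move=> ab e; have [+ _] := (valueP d b _).1 erefl.
  by move/negP; apply; apply/mapP; exists a; rewrite // mem_iota.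
by move=> a b e; case: (ltngtP a b) => // ab; [case: (key _ _ ab)|case: (key _ _ ab)].
Qed.

(** Values and digits determine each other step by step, so a prescription of the first
    values is a prescription of the first digits. *)
Lemma values_digits d n (f : nat -> nat) : injective f ->
  (forall k, k < n -> value d k = f k) <->
  (forall k, k < n -> d k = rank (mkseq f k) (f k)).
Proof.
move=> fi.
have E m : (forall k, k < m -> value d k = f k) -> mkseq (value d) m = mkseq f m.
  by move=> h; apply/eq_in_map => k; rewrite mem_iota => ?; exact: h.
split=> h k kn.
  have [_ <-] := (valueP d k _).1 (h k kn); rewrite E // => i ik.
  by apply: h; lia.
elim/ltn_ind: k kn => k IHk kn; apply/valueP; rewrite E; last first.
  by move=> i ik; apply: IHk => //; lia.
split; last by rewrite h.
by apply/mapP => -[i]; rewrite mem_iota => ik /fi; lia.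
Qed.

Lemma value_determined n v : determined n.+1 (fun d => value d n = v).
Proof.
move=> f g fg <-.
have E k : k <= n -> picks g k = picks f k.
  by elim: k => // k IHk kn /=; rewrite IHk ?fg //; lia.
by rewrite /value E // fg.
Qed.

(** When the digit is 0 the smallest unused value is taken.  Once all values below v
    have been used, the next digit 0 takes v unless v has been used already. *)
Lemma value_surj d : (forall N, exists k, N <= k /\ d k = 0) ->
  forall v, exists n, value d n = v.
Proof.
move=> dinf; elim/ltn_ind => v IHv.
have [N HN] : exists N, forall u, u < v -> exists n, n < N /\ value d n = u.
  elim: v IHv => [|v IH] IHv; first by exists 0.
  have [N HN] : exists N, forall u, u < v -> exists n, n < N /\ value d n = u.
    by apply: IH => u uv; apply: IHv; lia.
  have [n vn] := IHv v (ltnSn v); exists (N + n.+1) => u.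
  rewrite ltnS leq_eqVlt => /orP[/eqP ->|/HN[k [kN ku]]].
    by exists n; split=> //; lia.
  by exists k; split=> //; lia.
have [k [Nk dk]] := dinf N.
have [vk rk] := (valueP d k _).1 erefl.
case: (ltngtP (value d k) v) => h; last by exists k.
  have [n [nN nv]] := HN _ h.
  by have := value_inj nv; lia.
have : rank (mkseq (value d) k) v.+1 = 0.
  by apply/eqP; rewrite -leqn0 -dk -rk rank_le.
rewrite rankS; case: (boolP (v \in _)) => [/mapP[n _ ->] _|_]; first by exists n.
by lia.
Qed.

Lemma rank_uniq l x : uniq l -> rank l x + count (fun y => y < x) l = x.
Proof.
move=> ul; have := count_predC (fun y => y \in l) (iota 0 x).
rewrite size_iota; suff -> : count (fun y => y \in l) (iota 0 x) = count (fun y => y < x) l.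
  by rewrite /rank; set a := count _ _; set b := count _ _; lia.
rewrite -!size_filter; apply/perm_size/uniq_perm.
- by rewrite filter_uniq // iota_uniq.
- by rewrite filter_uniq.
- by move=> y; rewrite !mem_filter mem_iota add0n /= andbC.
Qed.

(** Of the k earlier values, those below f k lower its rank and the others create an
    inversion with it; this turns ranks into inversion counts. *)
Lemma rank_mkseq f k : injective f ->
  rank (mkseq f k) (f k) + k = f k + \sum_(i <- iota 0 k) (f k < f i).
Proof.
move=> fi; have ul : uniq (mkseq f k) by rewrite map_inj_uniq // iota_uniq.
have := rank_uniq (f k) ul.
have : count (fun y => y < f k) (mkseq f k) + count (fun y => f k < y) (mkseq f k) = k.
  rewrite -[RHS](size_mkseq f k) -(count_predC (fun y => y < f k)); congr (_ + _).
  apply: eq_in_count => y /mapP[i]; rewrite mem_iota => ik -> /=.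
  have : f k <> f i by move=> /fi; lia.
  lia.
have -> : \sum_(i <- iota 0 k) (f k < f i) = count (fun y => f k < y) (mkseq f k).
  by rewrite -[RHS]sum1_count [RHS]big_mkcond [RHS]big_map; apply: eq_bigr => i _ /=; case: ltnP.
lia.
Qed.

End picks.

(** * Window cylinders of balanced permutations *)

Implicit Types s t u : borel Sbal.

(** Signs are those of the identity outside the window of size m. *)
Definition tame (m : nat) : set (borel Sbal) :=
  [set s | forall j : int, (j <= - m%:Z -> act s j <= 0) /\ (m%:Z < j -> 1 <= act s j)].

Definition cyl (m : nat) (l : seq int) : set (borel Sbal) :=
  [set s | tame m s /\ map (act s) (win m) = l].

Definition cylof (m : nat) s := cyl m (map (act s) (win m)).

Lemma cylofP m s t : cylof m s t <-> tame m t /\ {in win m, act t =1 act s}.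
Proof. by split=> -[tm /act_win]. Qed.

Lemma tameW m n s : (m <= n)%N -> tame m s -> tame n s.
Proof. by move=> mn sm j; have [a b] := sm j; split=> ?; [apply: a|apply: b]; lia. Qed.

Lemma finite_int_bounded (A : set int) : finite_set A ->
  exists N : nat, forall j, A j -> (absz j <= N)%N.
Proof.
move=> /finite_fsetP[B ->]; exists (\max_(j <- B) absz j)%N => j jB.
exact: leq_bigmax_seq.
Qed.

Lemma bal_admissible s : admissible (\val (s : tsg_type Sbal)).
Proof. by have := set_mem (valP (s : tsg_type Sbal)) => -[]. Qed.

Lemma bal_balance s : balance (\val (s : tsg_type Sbal)) = 0.
Proof. by have := set_mem (valP (s : tsg_type Sbal)) => -[]. Qed.

(** Admissibility leaves only finitely many sign changes, so some window contains them
    all. *)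
Lemma tame_ex s : exists m, tame m s.
Proof.
have [sp sn] := bal_admissible s.
have [M HM] := finite_int_bounded sp; have [N HN] := finite_int_bounded sn.
exists (M + N).+1 => j; split=> jm.
  case: (lerP (act s j) 0) => // sj.
  have /HN : nonpos_to_pos (\val (s : tsg_type Sbal)) j by rewrite /nonpos_to_pos /= -/(act s j); lia.
  by lia.
case: (lerP 1 (act s j)) => // sj.
have /HM : pos_to_nonpos (\val (s : tsg_type Sbal)) j by rewrite /pos_to_nonpos /= -/(act s j); lia.
by lia.
Qed.

(** The two finite sets counted by the balance have the same cardinality, so they are
    empty together. *)
Lemma bal_pos_nonpos s :
  (exists j, 1 <= j /\ act s j <= 0) <-> (exists j, j <= 0 /\ 1 <= act s j).
Proof.
have [sp sn] := bal_admissible s; have := bal_balance s; rewrite /balance.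
set p := \val _ in sp sn *.
move/eqP; rewrite subr_eq0 => /eqP[] cE.
have P : (exists j, 1 <= j /\ act s j <= 0) <-> fset_set (pos_to_nonpos p) != fset0.
  rewrite -(rwP (fset0Pn _)); split=> -[j].
    by exists j; rewrite in_fset_set // mem_set.
  by rewrite in_fset_set // inE; exists j.
have N : (exists j, j <= 0 /\ 1 <= act s j) <-> fset_set (nonpos_to_pos p) != fset0.
  rewrite -(rwP (fset0Pn _)); split=> -[j].
    by exists j; rewrite in_fset_set // mem_set.
  by rewrite in_fset_set // inE; exists j.
by rewrite P N -!cardfs_eq0 cE.
Qed.

Lemma measurable_act (H : transp_subgroup) (P : pred int) j :
  measurable [set s : borel H | P (act s j)].
Proof. exact: (@measurable_rel H (fun x _ => P x) j j). Qed.

Lemma measurable_tame m : measurable (tame m).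
Proof.
have -> : tame m = \bigcap_(k in [set: nat])
    ([set s | act s (- m%:Z - k%:Z) <= 0] `&` [set s | 1 <= act s (m%:Z + 1 + k%:Z)]).
  apply/seteqP; split=> s sm.
    move=> k _; split=> /=.
      by apply: (sm _).1; lia.
    by apply: (sm _).2; lia.
  move=> j; split=> jm.
    have [/= + _] := sm (absz (- m%:Z - j)%R) I.
    by rewrite (_ : - m%:Z - (absz (- m%:Z - j)%R)%:Z = j) //; lia.
  have [/= _] := sm (absz (j - m%:Z - 1)%R) I.
  by rewrite (_ : m%:Z + 1 + (absz (j - m%:Z - 1)%R)%:Z = j) //; lia.
apply: bigcap_measurableType => // k _; apply: measurableI.
  exact: (measurable_act (fun a => a <= 0)).
exact: (measurable_act (fun a => 1 <= a)).
Qed.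

Lemma measurable_win m l : measurable [set s : borel Sbal | map (act s) (win m) = l].
Proof.
rewrite win_fibre; case: ifP => _ //.
by apply: bigcap_measurableType => // k _; exact: measurable_eval.
Qed.

Lemma measurable_cyl m l : measurable (cyl m l).
Proof. by apply: measurableI; [exact: measurable_tame | exact: measurable_win]. Qed.

(** Only windows of size at least m0 are kept, so that given positions can be assumed to
    lie inside all windows; the empty set is added for stability under intersection. *)
Definition cyls (m0 : nat) : set (set (borel Sbal)) :=
  [set A | A = set0 \/ exists m l, (m0 <= m)%N /\ A = cyl m l].

Lemma cyl_cylof m l s : cyl m l s -> cyl m l = cylof m s.
Proof. by move=> [_ <-]. Qed.

(** Of two cylinders that meet, the one of the larger window is contained in the other. *)
Lemma cyls_setI m0 : setI_closed (cyls m0).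
Proof.
have key m l n l' : (m <= n)%N ->
    cyl m l `&` cyl n l' = set0 \/ cyl m l `&` cyl n l' = cyl n l'.
  move=> mn; case: (pselect (exists s, (cyl m l `&` cyl n l') s)); last first.
    by move=> nA; left; apply/seteqP; split=> s // As; exfalso; apply: nA; exists s.
  move=> [s [sm sn]]; right; apply/seteqP; split=> t; first by case.
  move=> tn; split=> //; rewrite (cyl_cylof sm); rewrite (cyl_cylof sn) in tn.
  have [tmt ts] := (cylofP n s t).1 tn; apply/cylofP; split; last first.
    by move=> j jm; apply: ts; move: jm; rewrite !mem_win; lia.
  have [sm' _] := sm; move=> j; have [a b] := sm' j; have [c d] := tmt j.
  have E : j \in win n -> act t j = act s j by exact: ts.
  by move: E; rewrite mem_win; split=> jm; case: (boolP (1 - n%:Z <= j <= n%:Z)) => jn;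
    [rewrite E // a|apply: c; lia|rewrite E // b|apply: d; lia].
move=> A B [->|[m [l [mm ->]]]] [->|[n [l' [nm ->]]]];
  rewrite ?set0I ?setI0; try by left.
have [mn|nm'] := leqP m n.
  by case: (key m l n l' mn) => ->; [left|right; exists n, l'].
rewrite setIC; case: (key n l' m l (ltnW nm')) => ->; [by left|by right; exists m, l].
Qed.

Lemma cyls_measurable m0 : cyls m0 `<=` measurable.
Proof. by move=> _ [->|[m [l [_ ->]]]] //; exact: measurable_cyl. Qed.

(** Each coordinate set is a countable union of cylinders, because every permutation
    lies in a cylinder of every large enough window. *)
Lemma cyls_generate m0 (A : set (borel Sbal)) : measurable A -> <<s cyls m0 >> A.
Proof.
apply: smallest_sub; first exact: smallest_sigma_algebra.
apply: open_sub_sigma => j a.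
pose GT := g_sigma_algebraType (cyls m0).
have -> : [set s : tsg_type Sbal | act s j = a] = \bigcup_(c : nat * seq int)
   (if (m0 <= c.1)%N && `[< cyl c.1 c.2 `<=` [set s | act s j = a] >] then cyl c.1 c.2
    else set0).
  apply/seteqP; split=> s /=; last first.
    by move=> [c _]; case: ifP => // /andP[_ /asboolP]; exact.
  move=> sj; have [m sm] := tame_ex s.
  (* Large enough for the cylinder of s to be of the system and to fix the value at j. *)
  pose n := maxn (maxn m0 m) (absz j).+1.
  have sn : cylof n s s by split=> //; apply: tameW sm; rewrite /n; lia.
  exists (n, map (act s) (win n)) => //=; rewrite ifT //.
  apply/andP; split; first by rewrite /n; lia.
  apply/asboolP => t /cylofP[_ ts] /=; rewrite ts // mem_win /n; lia.
apply: (@countable_bigcupT_measurable _ GT) => [|c]; first exact: countableP.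
case: ifP => [/andP[mc _]|_]; last exact: (@measurable0 _ GT).
by apply: sub_sigma_algebra; right; exists c.1, c.2.
Qed.

(** Uniqueness of measures on an intersection-stable generator; the countably many
    cylinders also cover the space by sets of finite measure. *)
Lemma cyl_measure_eq (R : realType) (m1 m2 : {measure set (borel Sbal) -> \bar R}) m0 :
  (m1 setT < +oo)%E -> (forall m l, (m0 <= m)%N -> m1 (cyl m l) = m2 (cyl m l)) ->
  forall A, measurable A -> m1 A = m2 A.
Proof.
move=> m1oo m12 A mA.
pose g (k : nat) : set (borel Sbal) :=
  if @choice.pickle_inv (nat * seq int)%type k is Some c then
    (if (m0 <= c.1)%N then cyl c.1 c.2 else set0) else set0.
apply: (@g_sigma_algebra_measure_unique _ R _ (cyls m0) _ g).
- exact: cyls_measurable.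
- move=> k; rewrite /g; case: choice.pickle_inv => [c|]; last by left.
  by case: ifP => ?; [right; exists c.1, c.2|left].
- apply/seteqP; split=> // s _; have [m sm] := tame_ex s.
  exists (choice.pickle (maxn m0 m, map (act s) (win (maxn m0 m)))) => //.
  rewrite /g choice.pickleK_inv /= leq_maxl; split=> //.
  by apply: tameW sm; rewrite leq_maxr.
- exact: cyls_setI.
- by move=> B [->|[m [l [mm ->]]]]; rewrite ?measure0 // m12.
- move=> k; apply: le_lt_trans m1oo; apply: le_measure; rewrite ?inE //.
  apply: (@cyls_measurable m0); rewrite /g; case: choice.pickle_inv => [c|]; last by left.
  by case: ifP => ?; [right; exists c.1, c.2|left].
- exact: cyls_generate.
Qed.

(** * The weight of a window *)

Definition winv (m : nat) (f : int -> int) : nat :=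
  (\sum_(i <- win m) \sum_(j <- win m) ((i < j)%R && (f j < f i)%R))%N.

Definition wabs (m : nat) (f : int -> int) : nat := (\sum_(j <- win m) absz (f j))%N.

Lemma perm_win_swap m j : j \in win m -> j + 1 \in win m ->
  perm_eq (map (adj_swap j) (win m)) (win m).
Proof.
move=> jm j1m; apply: uniq_perm; rewrite ?win_uniq //.
  by rewrite map_inj_uniq ?win_uniq //; exact: inv_inj (adj_swapK j).
move=> i; apply/mapP/idP => [[k]|im].
  by move: jm j1m; rewrite !mem_win /adj_swap => ? ? ? ->; do !case: eqP => //; lia.
exists (adj_swap j i); last by rewrite adj_swapK.
by move: jm j1m im; rewrite !mem_win /adj_swap => ? ? ?; do !case: eqP => //; lia.
Qed.

Lemma sum_win_swap (F : int -> nat) m j : j \in win m -> j + 1 \in win m ->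
  (\sum_(i <- win m) F (adj_swap j i) = \sum_(i <- win m) F i)%N.
Proof.
by move=> jm j1m; rewrite -[RHS](perm_big _ (perm_win_swap jm j1m)) [RHS]big_map.
Qed.

Lemma wabs_swap m j f : j \in win m -> j + 1 \in win m ->
  wabs m (f \o adj_swap j) = wabs m f.
Proof. exact: (@sum_win_swap (fun i => absz (f i))). Qed.

(** After reindexing by the swap, the inversion counts differ only in the pair made of j
    and j + 1. *)
Lemma winv_swap m j f : j \in win m -> j + 1 \in win m -> f j < f (j + 1) ->
  winv m (f \o adj_swap j) = (winv m f).+1.
Proof.
move=> jm j1m fj; rewrite /winv /=.
transitivity (\sum_(i <- win m) \sum_(k <- win m)
    ((adj_swap j i < adj_swap j k)%R && (f k < f i)%R))%N.
  rewrite -(sum_win_swap _ jm j1m); apply: eq_bigr => i _.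
  rewrite -(sum_win_swap _ jm j1m); apply: eq_bigr => k _.
  by rewrite !adj_swapK.
transitivity (\sum_(i <- win m) \sum_(k <- win m)
    (((i < k)%R && (f k < f i)%R) + (i == (j + 1)%R) * (k == j)))%N.
  apply: eq_bigr => i _; apply: eq_bigr => k _; rewrite /adj_swap.
  case: (eqVneq i j) => [->|ij]; case: (eqVneq k j) => [->|kj].
  - by rewrite ltxx (_ : j == j + 1 = false) //; lia.
  - by case: (eqVneq k (j + 1)) => [->|kj1]; rewrite (_ : j == j + 1 = false); lia.
  - case: (eqVneq i (j + 1)) => [->|ij1].
      by rewrite fj !andbT; lia.
    by rewrite muln1 addn0; congr (nat_of_bool (_ && _)); lia.
  - rewrite muln0 addn0; congr (nat_of_bool (_ && _)).
    by case: (eqVneq i (j + 1)) => [->|ij1]; case: (eqVneq k (j + 1)) => [->|kj1]; lia.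
under eq_bigr do rewrite big_split /=.
rewrite big_split /= -addn1; congr addn.
rewrite (bigD1_seq (j + 1)) ?win_uniq //= (bigD1_seq j) ?win_uniq //=.
rewrite !eqxx big1 ?big1 // => [i /negbTE ->|k /negbTE ->]; rewrite ?muln0 ?mul0n //.
by rewrite big1.
Qed.

(** Replacing k+1 by the unused value k does not affect any comparison. *)
Lemma winv_adj_value m k f : {in win m, forall i, f i <> k} ->
  winv m (adj_swap k \o f) = winv m f.
Proof.
move=> fk; apply: eq_big_seq => i im; apply: eq_big_seq => j jm /=.
congr (nat_of_bool (_ && _)); have := fk _ im; have := fk _ jm.
by rewrite /adj_swap; do !case: eqP => //; lia.
Qed.

Lemma winv_adj_value1 m k f : {in win m, forall i, f i <> k + 1} ->
  winv m (adj_swap k \o f) = winv m f.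
Proof.
move=> fk; apply: eq_big_seq => i im; apply: eq_big_seq => j jm /=.
congr (nat_of_bool (_ && _)); have := fk _ im; have := fk _ jm.
by rewrite /adj_swap; do !case: eqP => //; lia.
Qed.

Lemma eq_winv m f g : {in win m, f =1 g} -> winv m f = winv m g.
Proof.
by move=> fg; apply: eq_big_seq => i im; apply: eq_big_seq => j jm; rewrite !fg.
Qed.

Lemma eq_wabs m f g : {in win m, f =1 g} -> wabs m f = wabs m g.
Proof. by move=> fg; apply: eq_big_seq => i im; rewrite fg. Qed.

Lemma wabs_adj_value m k j f : injective f -> j \in win m -> f j = k + 1 ->
  {in win m, forall i, f i <> k} ->
  (wabs m (adj_swap k \o f) + absz (k + 1)%R = wabs m f + absz k)%N.
Proof.
move=> fi jm fj fk; rewrite /wabs !(bigD1_seq j) ?win_uniq //= fj.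
rewrite [X in (_ + X + _)%N](_ : _ = (\sum_(i <- win m | i != j) absz (f i))%N).
  by rewrite {1}/adj_swap; do !case: eqP => //; lia.
rewrite big_seq_cond [in RHS]big_seq_cond; apply: eq_bigr => i /andP[im /eqP ij].
have := fk _ im; have : f i <> f j by move=> /fi.
by rewrite fj /adj_swap; do !case: eqP => //.
Qed.

Lemma wabs_adj_value1 m k j f : injective f -> j \in win m -> f j = k ->
  {in win m, forall i, f i <> k + 1} ->
  (wabs m (adj_swap k \o f) + absz k = wabs m f + absz (k + 1)%R)%N.
Proof.
move=> fi jm fj fk; rewrite /wabs !(bigD1_seq j) ?win_uniq //= fj.
rewrite [X in (_ + X + _)%N](_ : _ = (\sum_(i <- win m | i != j) absz (f i))%N).
  by rewrite {1}/adj_swap; do !case: eqP => //; lia.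
rewrite big_seq_cond [in RHS]big_seq_cond; apply: eq_bigr => i /andP[im /eqP ij].
have := fk _ im; have : f i <> f j by move=> /fi.
by rewrite fj /adj_swap; do !case: eqP => //.
Qed.

Section weight.
Context (R : realType) (q : R) (q_gt0 : 0 < q) (q_lt1 : q < 1).

(** The mass of a window cylinder before normalization: the factor (1-q)^(2m) comes
    from 2m geometric variables, and m^2 is the sum of the absolute values of the
    identity on the window. *)
Definition weight (m : nat) (f : int -> int) : R :=
  (1 - q) ^+ (m + m) * q ^+ (winv m f + wabs m f) / q ^+ (m * m).

Lemma weight_gt0 m f : 0 < weight m f.
Proof. by rewrite /weight !mulr_gt0 ?invr_gt0 ?exprn_gt0 // subr_gt0. Qed.

Lemma eq_weight m f g : {in win m, f =1 g} -> weight m f = weight m g.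
Proof. by move=> fg; rewrite /weight (eq_winv fg) (eq_wabs fg). Qed.

Lemma weight_scale m f g : (winv m g + wabs m g = (winv m f + wabs m f).+1)%N ->
  weight m g = q * weight m f.
Proof. by rewrite /weight => ->; rewrite exprS; ring. Qed.

Lemma weight_swap m j f : j \in win m -> j + 1 \in win m -> f j < f (j + 1) ->
  weight m (f \o adj_swap j) = q * weight m f.
Proof.
by move=> jm j1m fj; apply: weight_scale; rewrite winv_swap // wabs_swap.
Qed.

End weight.

(** * Uniqueness *)

(** The swap of two positions of the window acts on cylinders. *)
Lemma cylof_right m j s : j \in win m -> j + 1 \in win m ->
  right_transl j @^-1` cylof m s = cylof m (right_transl j s).
Proof.
rewrite !mem_win => jm j1m.
have fwd u v : cylof m u v -> cylof m (right_transl j u) (right_transl j v).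
  move=> /cylofP[vm vu]; apply/cylofP; split=> i.
    have [a b] := vm (adj_swap j i); rewrite act_right.
    by split=> im; [apply: a|apply: b]; rewrite /adj_swap; do !case: eqP => //; lia.
  rewrite !act_right => im; apply: vu; move: im.
  by rewrite !mem_win /adj_swap => ?; do !case: eqP => //; lia.
apply/seteqP; split=> t; rewrite /preimage /=.
  by move/fwd; rewrite right_translK.
by move/fwd; rewrite right_translK.
Qed.

(** Exchanging the values k and k+1 preserves all signs unless k = 0; this is why the
    moves on values below avoid k = 0. *)
Lemma cylof_left m k s : k != 0 ->
  left_transl k @^-1` cylof m s = cylof m (left_transl k s).
Proof.
move=> k0.
have fwd u v : cylof m u v -> cylof m (left_transl k u) (left_transl k v).
  move=> /cylofP[vm vu]; apply/cylofP; split=> i.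
    have [a b] := vm i; rewrite act_left.
    split=> im; [have := a im|have := b im]; rewrite /adj_swap; do !case: eqP => //; lia.
  by rewrite !act_left => im; rewrite vu.
apply/seteqP; split=> t; rewrite /preimage /=.
  by move/fwd; rewrite left_translK.
by move/fwd; rewrite left_translK.
Qed.

Lemma tame_right m j s : j \in win m -> j + 1 \in win m -> tame m s ->
  tame m (right_transl j s).
Proof.
move=> jm j1m sm.
have : cylof m s s by [].
by rewrite -{2}(right_translK j s) -[X in X -> _]/((right_transl j @^-1` cylof m s) _)
  cylof_right // => -[].
Qed.

Lemma tame_left m k s : k != 0 -> tame m s -> tame m (left_transl k s).
Proof.
move=> k0 sm; have : cylof m s s by [].
by rewrite -{2}(left_translK k s) -[X in X -> _]/((left_transl k @^-1` cylof m s) _)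
  cylof_left // => -[].
Qed.

(** If the entries of the window increase, balancedness forces the value at 1 to be
    positive and the value at 0 to be non-positive, so entries at positive positions
    dominate their positions.  The first one that is too large can be lowered by one, and
    symmetrically on the other side. *)
Lemma bal_reduction m s : tame m s ->
  [\/ exists j, [/\ j \in win m, j + 1 \in win m & act s (j + 1) < act s j],
      exists j k, [/\ 1 <= k, j \in win m, act s j = k + 1 &
                      {in win m, forall i, act s i <> k}],
      exists j k, [/\ k <= -1, j \in win m, act s j = k &
                      {in win m, forall i, act s i <> k + 1}] |
      {in win m, forall j, act s j = j}].
Proof.
move=> sm.
case: (pselect (exists j, [/\ j \in win m, j + 1 \in win m & act s (j + 1) < act s j])).
  by move=> ?; apply: Or41.
move=> nodesc.
have step j : j \in win m -> j + 1 \in win m -> act s j + 1 <= act s (j + 1).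
  move=> jm j1m; have : act s j <> act s (j + 1) by move=> /act_injective; lia.
  case: (ltP (act s (j + 1)) (act s j)) => [h|]; last by lia.
  by exfalso; apply: nodesc; exists j.
have mono (n : nat) i : i \in win m -> i + n%:Z \in win m -> act s i + n%:Z <= act s (i + n%:Z).
  elim: n => [|n IHn] im inm; first by rewrite !addr0.
  have inm' : i + n%:Z \in win m by move: im inm; rewrite !mem_win; lia.
  have := IHn im inm'; have := step _ inm'.
  rewrite (_ : i + n%:Z + 1 = i + n.+1%:Z); last by lia.
  by move/(_ inm); lia.
have inc i j : i \in win m -> j \in win m -> i <= j -> act s i + (j - i) <= act s j.
  move=> im jm ij; have := mono (absz (j - i)%R) i im.
  by rewrite (_ : i + (absz (j - i)%R)%:Z = j); [move/(_ jm); lia|lia].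
have s1 : 1 \in win m -> 1 <= act s 1.
  move=> m1; case: (lerP 1 (act s 1)) => // s1.
  have [j [j0 sj]] : exists j, j <= 0 /\ 1 <= act s j.
    by apply/bal_pos_nonpos; exists 1; split=> //; lia.
  have jm : j \in win m by move: m1; rewrite !mem_win; have [a _] := sm j; lia.
  by have := inc _ _ jm m1; lia.
have s0 : 0 \in win m -> act s 0 <= 0.
  move=> m0; case: (lerP (act s 0) 0) => // s0.
  have [j [j0 sj]] : exists j, 1 <= j /\ act s j <= 0.
    by apply/bal_pos_nonpos; exists 0; split=> //; lia.
  have jm : j \in win m by move: m0; rewrite !mem_win; have [_ b] := sm j; lia.
  by have := inc _ _ m0 jm; lia.
have pos j : j \in win m -> 1 <= j -> j <= act s j.
  move=> jm j1; have m1 : 1 \in win m by move: jm; rewrite !mem_win; lia.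
  by have := s1 m1; have := inc _ _ m1 jm; lia.
have neg j : j \in win m -> j <= 0 -> act s j <= j.
  move=> jm j1; have m0 : 0 \in win m by move: jm; rewrite !mem_win; lia.
  by have := s0 m0; have := inc _ _ jm m0; lia.
case: (pselect (exists n : nat, (n.+1%:Z \in win m) && (act s n.+1%:Z != n.+1%:Z))).
  move=> ex; case: (ex_minnP ex) => n /andP[nm sn] nmin; apply: Or42.
  have sn' := pos _ nm; exists n.+1%:Z, (act s n.+1%:Z - 1); split=> //; try lia.
  move=> i im si; have ni : i < n.+1%:Z.
    by case: (ltP i n.+1%:Z) => // ni; have := inc _ _ nm im ni; lia.
  have i1 : 1 <= i by case: (lerP 1 i) => // i1; have := neg _ im; lia.
  have := nmin (absz (i - 1)%R); rewrite (_ : (absz (i - 1)%R).+1%:Z = i); last by lia.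
  by rewrite im /=; case: eqP => [|_ /(_ isT)]; lia.
move=> npos.
case: (pselect (exists n : nat, (- n%:Z \in win m) && (act s (- n%:Z) != - n%:Z))).
  move=> ex; case: (ex_minnP ex) => n /andP[nm sn] nmin; apply: Or43.
  have sn' := neg _ nm; exists (- n%:Z), (act s (- n%:Z)); split=> //; try lia.
  move=> i im si; have ni : - n%:Z < i.
    by case: (ltP (- n%:Z) i) => // ni; have := inc _ _ im nm ni; lia.
  have i1 : i <= 0 by case: (lerP i 0) => // i1; have := pos _ im; lia.
  have := nmin (absz i); rewrite (_ : - (absz i)%:Z = i); last by lia.
  by rewrite im /=; case: eqP => [|_ /(_ isT)]; lia.
move=> nneg; apply: Or44 => j jm; apply/eqP/negPn/negP => sj.
case: (lerP 1 j) => j1.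
  by apply: npos; exists (absz (j - 1)%R); rewrite (_ : (absz (j - 1)%R).+1%:Z = j) ?jm //; lia.
by apply: nneg; exists (absz j); rewrite (_ : - (absz j)%:Z = j) ?jm //; lia.
Qed.

Definition bal1 : borel Sbal := (1%g : tsg_type Sbal).

Lemma act_bal1 : act bal1 =1 id. Proof. by []. Qed.

Lemma tame_bal1 m : tame m bal1.
Proof. by move=> j; rewrite act_bal1; lia. Qed.

Lemma measurable_cylof m s : measurable (cylof m s).
Proof. exact: measurable_cyl. Qed.

Section uniqueness.
Context (R : realType) (q : R) (q_gt0 : 0 < q) (q_lt1 : q < 1).
Local Notation wt := (weight q).

(** Induction on the exponent of the weight: each move of [bal_reduction] lowers it by
    one and divides both sides by q.  For a move on values, the missing value lies beyond
    the window, on the side of its sign, so the order of the two positions is known on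
    the whole cylinder. *)
Lemma cylof_weight (P : {measure set (borel Sbal) -> \bar R}) m s :
  right_q_exchangeable q P -> left_q_exchangeable q P -> tame m s ->
  (P (cylof m s) = (wt m (act s) / wt m id)%:E * P (cylof m bal1))%E.
Proof.
move=> /(right_exchP q_gt0) Pr /(left_exchP q_gt0) Pl.
have [n] := ubnP (winv m (act s) + wabs m (act s)); elim: n s => // n IHn s.
rewrite ltnS => sn sm.
have step t : tame m t -> P (cylof m s) = (q%:E * P (cylof m t))%E ->
    (winv m (act s) + wabs m (act s) = (winv m (act t) + wabs m (act t)).+1)%N ->
    (P (cylof m s) = (wt m (act s) / wt m id)%:E * P (cylof m bal1))%E.
  move=> tm -> st; rewrite IHn //; last by lia.
  by rewrite (weight_scale q st) muleA -EFinM mulrA.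
case: (bal_reduction sm) => [[j [jm j1m sj]]|[j [k [k1 jm sj sk]]]|[j [k [k1 jm sj sk]]]|sid].
- have tj : act (right_transl j s) j < act (right_transl j s) (j + 1).
    rewrite !act_right /adj_swap eqxx; rewrite (_ : j + 1 == j = false); last by lia.
    by rewrite eqxx.
  apply: (step (right_transl j s)); first exact: tame_right.
    rewrite -{1}(right_translK j s) -cylof_right // Pr //; first exact: measurable_cylof.
    move=> u /cylofP[_ us]; by rewrite /pos_ascent /= !us.
  rewrite -[in LHS](right_translK j s).
  by have := winv_swap jm j1m tj; have := wabs_swap (act (right_transl j s)) jm j1m;
     rewrite -![act (right_transl j s) \o _]/(act (right_transl j (right_transl j s)));
     lia.
- have k0 : k != 0 by lia.
  have E := wabs_adj_value (@act_injective _ s) jm sj sk.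
  have F := winv_adj_value sk.
  have tm := tame_left k0 sm.
  have tk : act (left_transl k s) j = k.
    by rewrite act_left sj /adj_swap; do !case: eqP => //; lia.
  apply: (step (left_transl k s)) => //.
    rewrite -{1}(left_translK k s) -cylof_left // Pl //; first exact: measurable_cylof.
    move=> u /cylofP[um us]; rewrite /val_ascent /=.
    have -> : act (inv_borel u) k = j by apply/act_inv_eq; rewrite us.
    set j' := act _ _; have uj : act u j' = k + 1 by apply/act_inv_eq.
    have j'm : j' \notin win m.
      apply/negP => j'm; have := sk _ j'm; apply.
      move: uj; rewrite us // act_left => e.
      by rewrite -(adj_swapK k (act s j')) e /adj_swap; do !case: eqP => //; lia.
    by move: j'm jm; rewrite !mem_win; have [a b] := um j'; lia.
  rewrite (_ : act (left_transl k s) = adj_swap k \o act s) // F.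
  by move: E; clear -k1; move: (winv _ _) (wabs _ _) (wabs _ _) => ? ? ?; lia.
- have k0 : k != 0 by lia.
  have E := wabs_adj_value1 (@act_injective _ s) jm sj sk.
  have F := winv_adj_value1 sk.
  have tm := tame_left k0 sm.
  have tk : act (left_transl k s) j = k + 1.
    by rewrite act_left sj /adj_swap; do !case: eqP => //; lia.
  apply: (step (left_transl k s)) => //.
    rewrite -{1}(left_translK k s) -cylof_left // Pl //; first exact: measurable_cylof.
    move=> u /cylofP[um us]; rewrite /val_ascent /=.
    have -> : act (inv_borel u) (k + 1) = j by apply/act_inv_eq; rewrite us.
    set j' := act _ _; have uj : act u j' = k by apply/act_inv_eq.
    have j'm : j' \notin win m.
      apply/negP => j'm; have := sk _ j'm; apply.
      move: uj; rewrite us // act_left => e.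
      by rewrite -(adj_swapK k (act s j')) e /adj_swap; do !case: eqP => //; lia.
    by move: j'm jm; rewrite !mem_win; have [a b] := um j'; lia.
  rewrite (_ : act (left_transl k s) = adj_swap k \o act s) // F.
  by move: E; clear -k1; move: (winv _ _) (wabs _ _) (wabs _ _) => ? ? ?; lia.
- rewrite (@eq_weight R q m (act s) id) // divff ?mul1e ?gt_eqF ?weight_gt0 //.
  congr (P _); apply/seteqP; split=> u /cylofP[um us]; apply/cylofP; split=> // i im;
    by rewrite us // sid.
Qed.

(** The measure Q is only used as the witness that the weights of the cylinders of
    window m+1 inside one of window m add up to its weight. *)
Lemma exch_unique (P Q : probability (borel Sbal) R) (z : R) : 0 < z ->
  (forall m s, tame m s -> Q (cylof m s) = (z * wt m (act s))%:E) ->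
  right_q_exchangeable q P -> left_q_exchangeable q P ->
  forall A, measurable A -> P A = Q A.
Proof.
move=> z0 Qw Pr Pl.
(* The constant of proportionality between masses and weights for the window m. *)
pose u m := fine (P (cylof m bal1)) / wt m id.
have wn0 m : wt m id != 0 by rewrite gt_eqF // weight_gt0.
have Pu m s : tame m s -> (P (cylof m s) = (u m / z)%:E * Q (cylof m s))%E.
  move=> sm; rewrite (cylof_weight Pr Pl) // Qw // /u -EFinM.
  rewrite -[X in (_ * X)%E]fineK ?fin_num_measure //; last exact: measurable_cylof.
  rewrite -EFinM; congr EFin.
  have := wn0 m; have : z != 0 by rewrite gt_eqF.
  by move: (wt m id) (wt m _) (fine _) => a b c ? ?; field; apply/andP.
have uS m : u m.+1 = u m.
  have : (P (cylof m bal1) = (u m.+1 / z)%:E * Q (cylof m bal1))%E.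
    pose f s := map (act s) (win m.+1).
    apply: (@measure_scale_fibres _ _ _ _ _ _ _ _ f f) => //; try exact: measurable_cylof;
      try by move=> l; exact: measurable_win.
    move=> l; set A := _ `&` _.
    case: (pselect (exists t, A t)) => [[t [/cylofP[tm t1] tl]]|nA].
      suff -> : A = cylof m.+1 t.
        by apply: Pu; apply: tameW tm; lia.
      have tm1 : tame m.+1 t by apply: tameW tm; lia.
      apply/seteqP; split=> s.
        move=> [/cylofP[sm s1] sl]; split; last by rewrite -/(f t) tl.
        by apply: tameW sm; lia.
      move=> /cylofP[sm st]; split; last first.
        by rewrite -tl /= /f; apply/act_win.
      apply/cylofP; split=> j.
        have [a b] := sm j; have [c d] := tm j.
        have : j \in win m.+1 -> act s j = act t j by exact: st.
        rewrite mem_win => e.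
        by case: (boolP (1 - m.+1%:Z <= j <= m.+1%:Z)) => jm; [rewrite e //|lia].
      move=> jm; rewrite st ?t1 //; move: jm; rewrite !mem_win; lia.
    have -> : A = set0 by apply/seteqP; split=> s // As; exfalso; apply: nA; exists s.
    by rewrite !measure0 mule0.
  rewrite Pu; last exact: tame_bal1.
  rewrite Qw; last exact: tame_bal1.
  have X0 : z * wt m (act bal1) != 0 by rewrite mulf_neq0 // gt_eqF // weight_gt0.
  have z0' : z^-1 != 0 by rewrite invr_eq0 gt_eqF.
  by rewrite -!EFinM => -[/(mulIf X0)/(mulIf z0')].
have u0 m : u m = u 0%N by elim: m => // m IHm; rewrite uS.
have PQ A : measurable A -> (P A = (u 0%N / z)%:E * Q A)%E.
  have c0 : 0 <= u 0%N / z.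
    by rewrite !mulr_ge0 ?invr_ge0 ?fine_ge0 // ltW // weight_gt0.
  move=> mA.
  apply: (@cyl_measure_eq R P (mscale (NngNum c0) Q) 0) => //.
    by apply: le_lt_trans (probability_le1 P _) (ltry _); exact: measurableT.
  move=> m l _; rewrite /mscale /=.
  case: (pselect (exists s, cyl m l s)) => [[s sl]|nl].
    by rewrite (cyl_cylof sl) Pu ?u0 //; case: sl.
  have -> : cyl m l = set0 by apply/seteqP; split=> s // sl; exfalso; apply: nl; exists s.
  by rewrite !measure0.
(* Both measures have total mass 1. *)
have c1 : u 0%N / z = 1.
  have PT : P setT = 1%E := probability_setT P.
  have QT : Q setT = 1%E := probability_setT Q.
  by have := PQ _ (@measurableT _ (borel Sbal)); rewrite PT QT mule1 => -[].
by move=> A mA; rewrite PQ // c1 mul1e.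
Qed.

End uniqueness.

(** * The law of a sign-preserving permutation *)

(** The two permutations of the naturals into which a sign-preserving permutation splits;
    positions and values are shifted to start at 0 on the positive side and negated on the
    other side, so that inversions are preserved. *)
Definition pos_part (f : int -> int) (k : nat) : nat := absz (f (k%:Z + 1) - 1)%R.
Definition neg_part (f : int -> int) (k : nat) : nat := absz (f (- k%:Z)).

Lemma sign_parts s : tame 0 s -> forall k : nat,
  act s (k%:Z + 1) = (pos_part (act s) k)%:Z + 1 /\ act s (- k%:Z) = - (neg_part (act s) k)%:Z.
Proof.
move=> s0 k; rewrite /pos_part /neg_part.
by have [_ a] := s0 (k%:Z + 1); have [b _] := s0 (- k%:Z); lia.
Qed.

Lemma pos_part_inj s : tame 0 s -> injective (pos_part (act s)).
Proof.
move=> s0 a b e; have [ea _] := sign_parts s0 a; have [eb _] := sign_parts s0 b.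
have : act s (a%:Z + 1) = act s (b%:Z + 1) by rewrite ea eb e.
by move/act_injective; lia.
Qed.

Lemma neg_part_inj s : tame 0 s -> injective (neg_part (act s)).
Proof.
move=> s0 a b e; have [_ ea] := sign_parts s0 a; have [_ eb] := sign_parts s0 b.
have : act s (- a%:Z) = act s (- b%:Z) by rewrite ea eb e.
by move/act_injective; lia.
Qed.

Lemma perm_winS m : perm_eq (win m.+1) [:: - m%:Z, m%:Z + 1 & win m].
Proof.
apply: uniq_perm; rewrite ?win_uniq //.
  by rewrite /= !inE !mem_win win_uniq; lia.
by move=> j; rewrite mem_win 2!in_cons mem_win; lia.
Qed.

Lemma sum_win (F : int -> nat) m :
  (\sum_(j <- win m) F j = \sum_(k <- iota 0 m) (F (k%:Z + 1)%R + F (- k%:Z)%R))%N.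
Proof.
elim: m => [|m IHm]; first by rewrite !big_nil.
rewrite [LHS](perm_big _ (perm_winS m)) [LHS]big_cons [X in (_ + X = _)%N]big_cons IHm.
rewrite -[in RHS](addn1 m) iotaD big_cat big_seq1 /=.
by rewrite add0n addnA addnC [(F (- _)%R + _)%N]addnC.
Qed.

Lemma sum_winS (F : int -> nat) m :
  (\sum_(j <- win m.+1) F j =
   F (- m%:Z)%R + F (m%:Z + 1)%R + \sum_(j <- win m) F j)%N.
Proof.
by rewrite (perm_big _ (perm_winS m)) [LHS]big_cons [X in (_ + X = _)%N]big_cons addnA.
Qed.

(** Enlarging the window by one adds the positions -m and m+1.  On each side the new
    absolute value and the new inversions add up to a rank plus a correction of m or m+1
    by [rank_mkseq]; no inversion joins the two sides. *)
Lemma weight_exponent s m : tame 0 s ->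
  (winv m (act s) + wabs m (act s) =
   \sum_(k <- iota 0 m) (rank (mkseq (pos_part (act s)) k) (pos_part (act s) k) +
                         rank (mkseq (neg_part (act s)) k) (neg_part (act s) k))
   + m * m)%N.
Proof.
move=> s0; set f := act s; set p := pos_part f; set n := neg_part f.
elim: m => [|m IHm]; first by rewrite /winv /wabs !big_nil.
have [fp fn] := sign_parts s0 m; rewrite -/f -/p -/n in fp fn.
rewrite -[in RHS](addn1 m) iotaD big_cat big_seq1 /= add0n.
have P := rank_mkseq m (pos_part_inj s0); have N := rank_mkseq m (neg_part_inj s0).
have A : wabs m.+1 f = (n m + (p m).+1 + wabs m f)%N.
  rewrite /wabs sum_winS; congr (_ + _)%N.
  by rewrite fp fn; lia.
pose r i j : nat := (i < j)%R && (f j < f i)%R.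
have wE k : winv k f = (\sum_(i <- win k) \sum_(j <- win k) r i j)%N by [].
have r1 : (\sum_(j <- win m.+1) r (- m%:Z)%R j = \sum_(i <- iota 0 m) (n m < n i)%N)%N.
  rewrite sum_winS (sum_win (r (- m%:Z))) (_ : r (- m%:Z) (- m%:Z) = 0%N); last first.
    by rewrite /r ltxx.
  rewrite (_ : r (- m%:Z) (m%:Z + 1) = 0%N); last by rewrite /r fp fn; lia.
  rewrite !add0n; apply: eq_big_seq => k; rewrite mem_iota => km.
  have [kp kn] := sign_parts s0 k; rewrite -/f -/p -/n in kp kn.
  rewrite (_ : r (- m%:Z) (k%:Z + 1) = 0%N); last by rewrite /r kp fn; lia.
  by rewrite /r add0n kn fn; congr nat_of_bool; lia.
have r2 : (\sum_(j <- win m.+1) r (m%:Z + 1)%R j = 0)%N.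
  rewrite big_seq big1 // => j; rewrite mem_win => jm.
  by rewrite /r; case: ltP => //; lia.
have r3 : (\sum_(i <- win m) \sum_(j <- win m.+1) r i j =
           \sum_(i <- iota 0 m) (p m < p i)%N + winv m f)%N.
  rewrite wE -[X in (X + _)%N](_ : \sum_(i <- win m) (f (m%:Z + 1) < f i)%R = _)%N.
    rewrite -big_split; apply: eq_big_seq => i; rewrite mem_win => im.
    rewrite sum_winS (_ : r i (- m%:Z) = 0%N); last by rewrite /r; case: ltP => //; lia.
    by rewrite add0n /r (_ : (i < m%:Z + 1) = true) //; lia.
  rewrite (sum_win (fun i => (f (m%:Z + 1) < f i)%R : nat)).
  apply: eq_big_seq => k; rewrite mem_iota => km.
  have [kp kn] := sign_parts s0 k; rewrite -/f -/p -/n in kp kn.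
  rewrite kp kn fp (_ : (_ < - _ :> int) = false) ?addn0; last by lia.
  by congr nat_of_bool; lia.
have I : winv m.+1 f = (winv m f + \sum_(i <- iota 0 m) (p m < p i)%N
                                 + \sum_(i <- iota 0 m) (n m < n i)%N)%N.
  by rewrite wE (sum_winS (fun i => \sum_(j <- win m.+1) r i j)%N) r1 r2 r3; lia.
rewrite -/f -/p in P; rewrite -/f -/n in N.
by rewrite A I !mulnDl !mulnDr; lia.
Qed.

(** Inverse of the splitting into [pos_part] and [neg_part]. *)
Definition glue (c c' : nat -> nat) (j : int) : int :=
  if 1 <= j then (c (absz (j - 1)%R))%:Z + 1 else - (c' (absz j))%:Z.

Lemma glue_pos c c' (k : nat) : glue c c' (k%:Z + 1) = (c k)%:Z + 1.
Proof. by rewrite /glue ifT; [rewrite addrK|lia]. Qed.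

Lemma glue_neg c c' (k : nat) : glue c c' (- k%:Z) = - (c' k)%:Z.
Proof. by rewrite /glue ifF; [rewrite abszN|lia]. Qed.

Lemma int_sign_ind (P : int -> Prop) :
  (forall k : nat, P (k%:Z + 1)) -> (forall k : nat, P (- k%:Z)) -> forall j, P j.
Proof.
move=> Pp Pn j; case: (lerP 1 j) => j1.
  by rewrite (_ : j = (absz (j - 1)%R)%:Z + 1) //; lia.
by rewrite (_ : j = - (absz j)%:Z) //; lia.
Qed.

Lemma glue_bij c c' : injective c -> injective c' ->
  (forall v, exists n, c n = v) -> (forall v, exists n, c' n = v) ->
  bijective (glue c c').
Proof.
move=> ci ci' /choice[g gK] /choice[g' gK']; exists (glue g g').
- elim/int_sign_ind => k; rewrite ?glue_pos ?glue_neg ?glue_pos ?glue_neg.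
    by rewrite (ci _ _ (gK (c k))).
  by rewrite (ci' _ _ (gK' (c' k))).
- by elim/int_sign_ind => k; rewrite ?glue_pos ?glue_neg ?glue_pos ?glue_neg ?gK ?gK'.
Qed.

(** No position changes sign, so the two sets counted by the balance are empty. *)
Lemma glue_bal c c' : bijective (glue c c') ->
  exists s, act s =1 glue c c'.
Proof.
move=> gb; pose p := mkperm gb.
have pn : pos_to_nonpos p = set0.
  apply/seteqP; split=> j //; rewrite /pos_to_nonpos /=.
  by move: j; elim/int_sign_ind => k []; rewrite [p _]glue_pos + rewrite [p _]glue_neg; lia.
have np : nonpos_to_pos p = set0.
  apply/seteqP; split=> j //; rewrite /nonpos_to_pos /=.
  by move: j; elim/int_sign_ind => k []; rewrite [p _]glue_pos + rewrite [p _]glue_neg; lia.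
have bp : balanced p.
  by split; [split; rewrite ?pn ?np | rewrite /balance pn np subrr].
by exists (SigSub (mem_set bp : p \in tsg_set Sbal) : tsg_type Sbal).
Qed.

Definition evens (d : nat -> nat) (k : nat) : nat := d (2 * k)%N.
Definition odds (d : nat -> nat) (k : nat) : nat := d (2 * k + 1)%N.

(** Coded sequences are always injective, so this makes both of them bijections. *)
Definition good (d : nat -> nat) : Prop :=
  (forall v, exists n, value (evens d) n = v) /\ (forall v, exists n, value (odds d) n = v).

(** Bad digits are sent to the identity, which keeps the law carried by sign-preserving
    permutations. *)
Definition bal_of_digits (d : nat -> nat) : borel Sbal :=
  if `[< good d >] then
    xget bal1 [set s | act s =1 glue (value (evens d)) (value (odds d))]
  else bal1.

Lemma bal_of_goodE d : good d ->
  act (bal_of_digits d) =1 glue (value (evens d)) (value (odds d)).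
Proof.
move=> gd; rewrite /bal_of_digits ifT; last exact/asboolP.
have [g1 g2] := gd.
have [s sE] := glue_bal (glue_bij (@value_inj (evens d)) (@value_inj (odds d)) g1 g2).
by have /= := @xgetPex _ bal1 [set s | act s =1 glue (value (evens d)) (value (odds d))];
  apply; exists s.
Qed.

Lemma bal_of_digits_tame d : tame 0 (bal_of_digits d).
Proof.
case: (pselect (good d)) => gd; last first.
  by rewrite /bal_of_digits asboolF //; exact: tame_bal1.
move=> j; rewrite bal_of_goodE //; move: j; elim/int_sign_ind => k.
  by rewrite glue_pos; lia.
by rewrite glue_neg; lia.
Qed.

Section law.
Context (R : realType) (q : R) (q_gt0 : 0 < q) (q_lt1 : q < 1).
Local Notation D := (measurableTypeR R).
Local Notation dg := (unit_digits q).

Lemma measurable_value n v :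
  measurable [set x : D | value (evens (dg x)) n = v] /\
  measurable [set x : D | value (odds (dg x)) n = v].
Proof.
split.
  apply: (@measurable_determined _ q q_gt0 q_lt1 (2 * n).+1
    (fun d => value (evens d) n = v)) => f g fg.
  by apply: value_determined => k kn; rewrite /evens fg //; lia.
apply: (@measurable_determined _ q q_gt0 q_lt1 (2 * n).+2
    (fun d => value (odds d) n = v)) => f g fg.
by apply: value_determined => k kn; rewrite /odds fg //; lia.
Qed.

Lemma measurable_good : measurable [set x : D | good (dg x)].
Proof.
have -> : [set x : D | good (dg x)] = \bigcap_(v in [set: nat])
   ((\bigcup_n [set x : D | value (evens (dg x)) n = v]) `&`
    (\bigcup_n [set x : D | value (odds (dg x)) n = v])).
  apply/seteqP; split=> x.
    move=> [g1 g2] v _; have [n nv] := g1 v; have [n' nv'] := g2 v.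
    by split; [exists n|exists n'].
  by move=> h; split=> v; have [[n _ nv] [n' _ nv']] := h v I; [exists n|exists n'].
apply: bigcap_measurableType => // v _; apply: measurableI; apply: bigcupT_measurable => n.
  exact: (measurable_value n v).1.
exact: (measurable_value n v).2.
Qed.

Lemma measurable_bal_of_digits :
  measurable_fun setT (fun x : D => bal_of_digits (dg x)).
Proof.
apply: measurable_into => j a.
have -> : [set x : D | act (bal_of_digits (dg x)) j = a] =
   ([set x | good (dg x)] `&` [set x | glue (value (evens (dg x))) (value (odds (dg x))) j = a])
   `|` (~` [set x | good (dg x)] `&` [set x | j = a]).
  apply/seteqP; split=> x /=.
    case: (pselect (good (dg x))) => gx; first by rewrite bal_of_goodE //; left.
    by rewrite /bal_of_digits asboolF //; right.
  by move=> [[gx h]|[gx h]]; [rewrite bal_of_goodE|rewrite /bal_of_digits asboolF].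
have mg := measurable_good.
apply: measurableU; apply: measurableI => //; last first.
- by case: (pselect (j = a)) => ja; [rewrite (_ : [set _ | _] = setT)|rewrite (_ : [set _ | _] = set0)] => //;
    apply/seteqP; split.
- exact: measurableC.
move: j; elim/int_sign_ind => k.
  rewrite (_ : [set _ | _] = if (1 <= a) then
     [set x : D | value (evens (dg x)) k = absz (a - 1)%R] else set0).
    by case: ifP => _ //; exact: (measurable_value _ _).1.
  by apply/seteqP; split=> x /=; rewrite glue_pos; case: ifP => /=; lia.
rewrite (_ : [set _ | _] = if (a <= 0) then
   [set x : D | value (odds (dg x)) k = absz a] else set0).
  by case: ifP => _ //; exact: (measurable_value _ _).2.
by apply/seteqP; split=> x /=; rewrite glue_neg; case: ifP => /=; lia.
Qed.

(** A bad sequence has, from some place on, no digit 0 among its even or among its odd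
    entries. *)
Lemma leb01_good : leb01 R (~` [set x : D | good (dg x)]) = 0%E.
Proof.
apply/negligibleP; first exact: measurableC measurable_good.
pose Z b N : set D := [set x | forall k, dg x (2 * (N + k) + b)%N <> 0%N].
have mZ b N : measurable (Z b N).
  have -> : Z b N = \bigcap_(k in [set: nat]) ~` [set x : D | dg x (2 * (N + k) + b)%N = 0%N].
    by apply/seteqP; split=> x h k; [move=> _; exact: h|exact: (h k I)].
  apply: bigcap_measurableType => // k _; apply: measurableC.
  apply: (@measurable_determined _ q q_gt0 q_lt1 (2 * (N + k) + b).+1
     (fun d => d (2 * (N + k) + b)%N = 0%N)) => f g fg.
  by rewrite fg.
have nZ b : (leb01 R).-negligible (\bigcup_N Z b N).
  by apply: negligible_bigcup => N; apply/negligibleP => //; exact: leb01_no_zero.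
apply: negligibleS (negligibleU (nZ 0%N) (nZ 1%N)) => x ngx.
have inf b : ~ (\bigcup_N Z b N) x -> forall N, exists k, (N <= k)%N /\ dg x (2 * k + b)%N = 0%N.
  move=> nz N; apply: contrapT => h; apply: nz; exists N => // k xk.
  by apply: h; exists (N + k)%N; split=> //; lia.
apply: contrapT => /not_orP[n0 n1]; apply: ngx; split; apply: value_surj => N.
  by have [k [Nk xk]] := inf 0%N n0 N; exists k; split=> //; rewrite addn0 in xk.
by have [k [Nk xk]] := inf 1%N n1 N; exists k.
Qed.

Definition sign_law : {measure set (borel Sbal) -> \bar R} :=
  image_measure
    (leb01 R) measurable_bal_of_digits.

(** Up to a null set, the cylinder prescribes the first m values of both permutations,
    hence the first 2m digits; the exponents are compared by [weight_exponent]. *)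
Lemma sign_law_cylof m s : tame 0 s -> sign_law (cylof m s) = (weight q m (act s))%:E.
Proof.
move=> s0; pose A := (fun x : D => bal_of_digits (dg x)) @^-1` cylof m s.
change (leb01 R A = (weight q m (act s))%:E).
pose p := pos_part (act s); pose n := neg_part (act s).
(* The digits forced by the cylinder: ranks of the two permutations, interleaved. *)
pose F k := if odd k then rank (mkseq n k./2) (n k./2) else rank (mkseq p k./2) (p k./2).
pose B : set D := [set x | forall k, (k < m + m)%N -> dg x k = F k].
have mg := measurable_good.
have mA : measurable A.
  rewrite -[X in measurable X]setTI; apply: measurable_bal_of_digits => //.
  exact: measurable_cylof.
have mB : measurable B by exact: measurable_prefix.
have full C : measurable C -> leb01 R C = leb01 R (C `&` [set x : D | good (dg x)]).
  move=> mC; rewrite -[in LHS](setIT C) -(setUv [set x : D | good (dg x)]) setIUr measureU //.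
  - rewrite [X in (_ + X)%E](_ : _ = 0%E) ?adde0 //.
    apply/eqP; rewrite eq_le measure_ge0 andbT -leb01_good; apply: le_measure;
      rewrite ?inE //; try exact: measurableC.
    by apply: measurableI => //; exact: measurableC.
  - exact: measurableI.
  - by apply: measurableI => //; exact: measurableC.
  - by rewrite -setIIr setICr setI0.
have AB : A `&` [set x : D | good (dg x)] = B `&` [set x : D | good (dg x)].
  have st x : good (dg x) -> A x <->
     (forall k, (k < m)%N -> value (evens (dg x)) k = p k) /\
     (forall k, (k < m)%N -> value (odds (dg x)) k = n k).
    move=> gx; rewrite /A /= (cylofP m s (bal_of_digits (dg x))); split.
      move=> [_ h]; split=> k km; have [ep en] := sign_parts s0 k.
        have := h (k%:Z + 1); rewrite mem_win bal_of_goodE // glue_pos ep => e.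
        by have := e ltac:(lia); rewrite -/p; lia.
      have := h (- k%:Z); rewrite mem_win bal_of_goodE // glue_neg en => e.
      by have := e ltac:(lia); rewrite -/n; lia.
    move=> [hp hn]; split; first by apply: tameW (bal_of_digits_tame _).
    elim/int_sign_ind => k; have [ep en] := sign_parts s0 k; rewrite mem_win => km.
      by rewrite bal_of_goodE // glue_pos ep hp //; lia.
    by rewrite bal_of_goodE // glue_neg en hn //; lia.
  have vd x := values_digits (evens (dg x)) m (pos_part_inj s0).
  have vd' x := values_digits (odds (dg x)) m (neg_part_inj s0).
  apply/seteqP; split=> x [h gx]; split=> //.
    have [/vd hp /vd' hn] := (st x gx).1 h => k km.
    have := hp k./2; have := hn k./2; rewrite /evens /odds /F -/p -/n.
    have := odd_double_half k; case: (odd k) => /= e a b.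
      by rewrite -a; [congr (dg x _)|]; lia.
    by rewrite -b; [congr (dg x _)|]; lia.
  apply/(st x gx); split; [apply/vd|apply/vd'] => k km.
    by rewrite /evens h /F ?mul2n ?odd_double ?doubleK //; lia.
  by rewrite /odds h /F ?mul2n ?addn1 /= ?odd_double ?uphalf_double //; lia.
have SF : (\sum_(i < m + m) F i = \sum_(k <- iota 0 m)
    (rank (mkseq p k) (p k) + rank (mkseq n k) (n k)))%N.
  elim: (m) => [|k IHk]; first by rewrite big_ord0 big_nil.
  rewrite -[in RHS](addn1 k) iotaD big_cat big_seq1 addSn addnS 2!big_ord_recr /= IHk.
  by rewrite /F addnn /= odd_double /= add0n uphalf_double doubleK addnA.
rewrite full // AB -full // leb01_prefix //; congr EFin.
rewrite /weight weight_exponent // big_split /= prodr_const card_ord -mulrA; congr (_ * _).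
by rewrite prodrXr exprD mulfK ?SF // expf_eq0 gt_eqF // andbF.
Qed.

End law.

(** * Sorting the sign word *)

Definition same_word s t := forall j, (1 <= act s j) = (1 <= act t j).

(** The distance to the middle of the line, rounded up and counted for the letters on the wrong side:
    a minus sign at a position j >= 1 costs j, a plus sign at j <= 0 costs 1 - j. *)
Definition letter_energy (j : int) (b : bool) : nat :=
  if 1 <= j then (if b then 0%N else absz j)
  else (if b then absz (1 - j)%R else 0%N).

Definition energy (m : nat) s : nat :=
  (\sum_(j <- win m) letter_energy j (1 <= act s j)%R)%N.

Definition swaps (l : seq int) s := foldl (fun t j => right_transl j t) s l.
Definition unswaps (l : seq int) s := foldr (fun j t => right_transl j t) s l.

Lemma unswapsK l s : unswaps l (swaps l s) = s.
Proof. by elim: l s => //= j l IHl s; rewrite IHl right_translK. Qed.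

Lemma same_word_right j s t : same_word s t ->
  same_word (right_transl j s) (right_transl j t).
Proof. by move=> st i; rewrite !act_right. Qed.

Lemma same_word_unswaps l s t : same_word s t -> same_word (unswaps l s) (unswaps l t).
Proof. by elim: l => //= j l IHl st; apply: same_word_right; exact: IHl. Qed.

Lemma same_word_tame0 s t : tame 0 s -> tame 0 t -> same_word s t.
Proof. by move=> s0 t0 j; have := s0 j; have := t0 j; lia. Qed.

Lemma same_word_tame m s t : same_word s t -> tame m s -> tame m t.
Proof. by move=> st sm j; have := sm j; have := st j; lia. Qed.

Lemma measurable_unswaps l : measurable_fun setT (unswaps l).
Proof.
elim: l => [|j l IHl] /=; first exact: measurable_id.
exact: measurableT_comp (@measurable_right Sbal j) IHl.
Qed.

Lemma word_descent s : ~ tame 0 s -> exists j, 1 <= act s j /\ act s (j + 1) <= 0.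
Proof.
move=> ns.
have [j0 sj0] : exists j, j <= 0 /\ 1 <= act s j.
  apply: contrapT => h; apply: ns => j; split=> j0.
    by case: (lerP (act s j) 0) => // sj; exfalso; apply: h; exists j; split=> //; lia.
  case: (lerP 1 (act s j)) => // sj; exfalso; apply: h; apply/bal_pos_nonpos.
  by exists j; lia.
have [j1 sj1] : exists j, 1 <= j /\ act s j <= 0 by apply/bal_pos_nonpos; exists j0.
have : act s (j0 + (absz (j1 - j0)%R)%:Z) <= 0.
  by rewrite (_ : j0 + (absz (j1 - j0)%R)%:Z = j1); lia.
elim: (absz _) => [|n IHn]; first by rewrite addr0; lia.
rewrite (_ : j0 + n.+1%:Z = j0 + n%:Z + 1); last by lia.
by case: (lerP (act s (j0 + n%:Z)) 0) => [h _|h1 h2]; [exact: IHn|exists (j0 + n%:Z); split=> //; lia].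
Qed.

Lemma descent_win m j s : tame m s -> 1 <= act s j -> act s (j + 1) <= 0 ->
  j \in win m /\ j + 1 \in win m.
Proof. by move=> sm sj sj1; rewrite !mem_win; have := sm j; have := sm (j + 1); lia. Qed.

(** The letter exchanged with its neighbour moves by one step.  The total drops by one,
    or by two when the swap straddles the middle. *)
Lemma energy_swap m j s : tame m s -> 1 <= act s j -> act s (j + 1) <= 0 ->
  (energy m (right_transl j s) < energy m s <= energy m (right_transl j s) + 2)%N.
Proof.
move=> sm sj sj1; have [jm j1m] := descent_win sm sj sj1.
have jj : j + 1 != j by lia.
have split_j (F : int -> nat) : (\sum_(i <- win m) F i =
    F j + (F (j + 1)%R + \sum_(i <- win m | (i != j) && (i != j + 1)%R) F i))%N.
  rewrite (bigD1_seq j) ?win_uniq //= -big_filter (bigD1_seq (j + 1)) ?filter_uniq ?win_uniq //=.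
    by rewrite big_filter_cond.
  by rewrite mem_filter jj.
rewrite /energy !split_j !act_right.
have -> : adj_swap j j = j + 1 by rewrite /adj_swap eqxx.
have -> : adj_swap j (j + 1) = j by rewrite /adj_swap (negbTE jj) eqxx.
rewrite (eq_bigr (fun i => letter_energy i (1 <= act s i))); last first.
  by move=> i /andP[/negbTE ij /negbTE ij1]; rewrite act_right /adj_swap ij ij1.
rewrite sj (_ : (1 <= act s (j + 1)) = false); last by lia.
rewrite /letter_energy; move: (\sum_(i <- _ | _) _)%N => E.
by case: (lerP 1 j) => ?; case: (lerP 1 (j + 1)) => ?; lia.
Qed.

Section sorting.
Context (R : realType) (q : R) (q_gt0 : 0 < q) (q_lt1 : q < 1).

(** A list of swaps that brings every permutation with the signs of s to a sign-preserving
    one, uniformly in the permutation and in the window: each swap removes one inversion,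
    so the weight changes by a power of q. *)
Definition sorting s (l : seq int) := forall t, same_word t s ->
  tame 0 (swaps l t) /\ forall m, tame m s ->
    [/\ weight q m (act t) = q ^+ size l * weight q m (act (swaps l t)),
        unswaps l @^-1` cylof m t = cylof m (swaps l t) &
        (energy m t <= 2 * size l)%N].

(** Induction on the energy, swapping a plus sign with a minus sign on its right.  Both
    positions lie in every window outside of which the signs are standard, so the list does
    not depend on the window. *)
Lemma sorting_ex s : exists l, sorting s l.
Proof.
have [m0 sm0] := tame_ex s.
have [n] := ubnP (energy m0 s); elim: n s sm0 => // n IHn s sm0 sn.
case: (pselect (tame 0 s)) => [s0|/word_descent[j [sj sj1]]].
  exists [::] => t ts; have t0 : tame 0 t by apply: same_word_tame s0 => j; rewrite ts.
  split=> // m sm; split; rewrite /= ?mul1r //.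
  rewrite leqn0 /energy big_seq big1 // => j _; rewrite /letter_energy.
  by have := t0 j; case: (lerP 1 j) => ?; case: (lerP 1 (act t j)); lia.
have es := energy_swap sm0 sj sj1.
have [jm0 j1m0] := descent_win sm0 sj sj1.
have [l lP] := IHn _ (tame_right jm0 j1m0 sm0) ltac:(lia).
exists (j :: l) => t ts; have [t0 tl] := lP _ (same_word_right j ts).
split=> // m sm; have [jm j1m] := descent_win sm sj sj1.
have [w pre e] := tl m (tame_right jm j1m sm).
have tm : tame m t by apply: same_word_tame sm => i; rewrite ts.
have [tj tj1] : 1 <= act t j /\ act t (j + 1) <= 0.
  by have := ts j; have := ts (j + 1); lia.
split=> /=.
- rewrite exprS -mulrA -w -[in LHS](right_translK j t).
  apply: (@weight_swap R q m j (act (right_transl j t))) => //.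
  rewrite !act_right /adj_swap eqxx (_ : j + 1 == j = false); last by lia.
  by rewrite eqxx; lia.
- by rewrite -pre -cylof_right.
- by have := energy_swap tm tj tj1; lia.
Qed.

End sorting.

(** The word of signs as an element of a countable type: the finite sets of positions
    with the wrong sign. *)
Definition code s : {fset int} * {fset int} :=
  (fset_set (pos_to_nonpos (\val (s : tsg_type Sbal))),
   fset_set (nonpos_to_pos (\val (s : tsg_type Sbal)))).

Lemma codeP s t : code s = code t <-> same_word s t.
Proof.
have [sp sn] := bal_admissible s; have [tp tn] := bal_admissible t.
split=> [[pE nE] j|st].
  have pj : j \in pos_to_nonpos (\val (s : tsg_type Sbal)) =
            (j \in pos_to_nonpos (\val (t : tsg_type Sbal))).
    by rewrite -!in_fset_set // pE.
  have nj : j \in nonpos_to_pos (\val (s : tsg_type Sbal)) =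
            (j \in nonpos_to_pos (\val (t : tsg_type Sbal))).
    by rewrite -!in_fset_set // nE.
  have P u : j \in pos_to_nonpos (\val (u : tsg_type Sbal)) = (1 <= j) && (act u j <= 0).
    by apply/idP/andP; rewrite inE.
  have N u : j \in nonpos_to_pos (\val (u : tsg_type Sbal)) = (j <= 0) && (1 <= act u j).
    by apply/idP/andP; rewrite inE.
  by move: pj nj; rewrite !P !N; lia.
rewrite /code; congr (fset_set _, fset_set _); apply/seteqP; split=> j;
  by rewrite /pos_to_nonpos /nonpos_to_pos /= -/(act s j) -/(act t j); have := st j; lia.
Qed.

Lemma measurable_code c : measurable [set s | code s = c].
Proof.
case: (pselect (exists s, code s = c)) => [[s <-]|nc]; last first.
  rewrite (_ : [set _ | _] = set0) //; apply/seteqP; split=> t // tc.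
  by apply: nc; exists t.
have -> : [set t | code t = code s] = \bigcap_(k in [set: nat])
   ([set t | (1 <= act t k%:Z) == (1 <= act s k%:Z)] `&`
    [set t | (1 <= act t (- k%:Z)) == (1 <= act s (- k%:Z))]).
  apply/seteqP; split=> t.
    by move/codeP => ts k _; split; apply/eqP; exact: ts.
  move=> h; apply/codeP => j; have [/= /eqP a /eqP b] := h (absz j) I.
  by case: (lerP 0 j) => j0; [rewrite (_ : j = (absz j)%:Z)|rewrite (_ : j = - (absz j)%:Z)] => //; lia.
apply: bigcap_measurableType => // k _; apply: measurableI.
  exact: (@measurable_act Sbal (fun a => (1 <= a) == (1 <= act s k%:Z))).
exact: (@measurable_act Sbal (fun a => (1 <= a) == (1 <= act s (- k%:Z)))).
Qed.

(** * The Mallows measure *)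

Section mallows.
Context (R : realType) (q : R) (q_gt0 : 0 < q) (q_lt1 : q < 1).
Local Notation M := (sign_law q_gt0 q_lt1).

Lemma sign_law_disjoint A : A `&` tame 0 = set0 -> M A = 0%E.
Proof.
move=> A0; have -> : M A = leb01 R set0.
  congr (leb01 R _); apply/seteqP; split=> // x Ax.
  have : (A `&` tame 0) (bal_of_digits (unit_digits q x)).
    by split=> //; exact: bal_of_digits_tame.
  by rewrite A0.
by rewrite measure0.
Qed.

Lemma sign_lawT : M setT = 1%E.
Proof. by rewrite -(leb01T R). Qed.

Lemma sign_law_full A : tame 0 `<=` A -> M A = 1%E.
Proof.
move=> A0; rewrite -sign_lawT; congr (leb01 R _); apply/seteqP; split=> // x _.
by apply: A0; exact: bal_of_digits_tame.
Qed.

Let expr_nneg n : 0 <= q ^+ n. Proof. by rewrite exprn_ge0 // ltW. Qed.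

(** Balanced permutations with a given word of signs form a coset of the sign-preserving
    ones; the law of the latter is transported to it and weighted by the cost of sorting. *)
Definition coset_law (l : seq int) : {measure set (borel Sbal) -> \bar R} :=
  mscale (NngNum (expr_nneg (size l)))
    (image_measure M
       (measurable_unswaps l)).

Lemma coset_lawE l A :
  coset_law l A = ((q ^+ size l)%:E * M (unswaps l @^-1` A))%E.
Proof. by []. Qed.

(** Undoing the swaps of l on a sign-preserving permutation produces the word of s and
    no other, so different cosets have disjoint supports. *)
Lemma coset_law_code s l t : sorting q s l -> code t <> code s ->
  coset_law l [set u | code u = code t] = 0%E.
Proof.
move=> sl ts; rewrite coset_lawE sign_law_disjoint ?mule0 //.
apply/seteqP; split=> u //= [/codeP ut u0]; apply: ts; apply/codeP.
have [s0 _] := sl s (fun=> erefl).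
have := same_word_unswaps l (same_word_tame0 u0 s0); rewrite unswapsK => us.
by move=> j; rewrite -us ut.
Qed.

Lemma mallows_sum : exists Q : {measure set (borel Sbal) -> \bar R},
  (forall m s, tame m s -> Q (cylof m s) = (weight q m (act s))%:E) /\
  (forall s, exists l, sorting q s l /\ Q [set u | code u = code s] = (q ^+ size l)%:E).
Proof.
have /choice[L LP] : forall c : {fset int} * {fset int},
    exists l, forall s, code s = c -> sorting q s l.
  move=> c; case: (pselect (exists s, code s = c)) => [[s sc]|nc].
    have [l sl] := sorting_ex q_gt0 q_lt1 s; exists l => t tc u ut.
    have st : same_word s t by apply/codeP; rewrite sc tc.
    have us : same_word u s by move=> j; rewrite ut st.
    have [u0 um] := sl u us; split=> // m tm; apply: um.
    by apply: same_word_tame tm => j; rewrite st.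
  by exists [::] => s sc; exfalso; apply: nc; exists s.
(* Codes of no permutation, and numbers that are not codes, contribute nothing. *)
pose mk (k : nat) : {measure set (borel Sbal) -> \bar R} :=
  match @choice.pickle_inv ({fset int} * {fset int})%type k with
  | Some c => if `[< exists s, code s = c >] then coset_law (L c) else mzero
  | None => mzero
  end.
have single A s : A `<=` [set u | code u = code s] -> measurable A ->
    mseries mk 0 A = coset_law (L (code s)) A.
  move=> As mA; rewrite /mseries (@nneseriesD1 _ _ (choice.pickle (code s))) //.
  rewrite /mk choice.pickleK_inv asboolT; last by exists s.
  rewrite eseries0 ?adde0 // => k _ /= ks.
  case kc : (choice.pickle_inv k) => [c|] //.
  case: ifP => // /asboolP[t tc].
  apply/eqP; rewrite eq_le measure_ge0 andbT.
  have st : code s <> code t.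
    move=> e; move/eqP: ks; apply.
    by have := @choice.pickle_invK ({fset int} * {fset int})%type k; rewrite kc /= -tc -e.
  rewrite -[leRHS](coset_law_code (LP c t tc) (t := s)) //.
  by apply: le_measure; rewrite ?inE //; exact: measurable_code.
exists (mseries mk 0); split=> [m s sm|s].
  rewrite -[LHS]/(mseries mk 0 (cylof m s)) (single _ s); last exact: measurable_cylof.
    have [s0 sP] := LP _ s erefl s (fun=> erefl).
    have [w pre _] := sP m sm.
    by rewrite coset_lawE pre sign_law_cylof // w EFinM.
  move=> u /cylofP[um us]; apply/codeP => j.
  case: (boolP (j \in win m)) => [/us -> //|]; rewrite mem_win => jm.
  by have [a b] := um j; have [c d] := sm j; lia.
exists (L (code s)); split; first exact: LP.
rewrite -[LHS]/(mseries mk 0 [set u | code u = code s]) (single _ s) //;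
  last exact: measurable_code.
rewrite coset_lawE sign_law_full ?mule1 // => u u0 /=; apply/codeP.
have [s0 _] := LP _ s erefl s (fun=> erefl).
have := same_word_unswaps (L (code s)) (same_word_tame0 u0 s0).
by rewrite unswapsK.
Qed.

End mallows.

Section mass.
Context (R : realType).

Lemma measure_bigsetU_le d (T : measurableType d) (mu : {measure set T -> \bar R})
    (I : Type) (r : seq I) (B : I -> set T) (b : I -> R) :
  (forall i, measurable (B i)) -> (forall i, (mu (B i) <= (b i)%:E)%E) ->
  (mu (\big[setU/set0]_(i <- r) B i) <= (\sum_(i <- r) b i)%:E)%E.
Proof.
move=> mB Bb; elim: r => [|i r IHr]; first by rewrite !big_nil measure0.
rewrite !big_cons EFinD; apply: le_trans (leeD (Bb i) IHr).
by apply: measureU2 => //; exact: bigsetU_measurable.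
Qed.

Lemma prod_win (F : int -> R) m :
  \prod_(j <- win m) F j = \prod_(k < m) (F (k%:Z + 1) * F (- k%:Z)).
Proof.
elim: m => [|m IHm]; first by rewrite big_nil big_ord0.
rewrite big_ord_recr /= -IHm (perm_big _ (perm_winS m)) [LHS]big_cons.
by rewrite [X in _ * X = _]big_cons mulrA [RHS]mulrC; congr (_ * _); rewrite mulrC.
Qed.

(** The sum over all words, balanced or not, factors over the positions of the window
    into the product of the (1 + p^(k+1))^2 for k < m, which 1 + x <= exp x bounds
    independently of m. *)
Lemma energy_sum_le (p : R) m : 0 < p -> p < 1 ->
  \sum_(w : {ffun 'I_(m + m) -> bool})
     \prod_(i < m + m) p ^+ letter_energy (nth 0 (win m) i) (w i)
  <= expR (2 * p / (1 - p)).
Proof.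
move=> p0 p1.
rewrite -(bigA_distr_bigA (fun (i : 'I_(m + m)) b => p ^+ letter_energy (nth 0 (win m) i) b)).
have -> : \prod_(i < m + m) \sum_(b : bool) p ^+ letter_energy (nth 0 (win m) i) b =
   \prod_(j <- win m) \sum_(b : bool) p ^+ letter_energy j b.
  rewrite [RHS](big_nth 0) size_map size_iota big_mkord; exact: eq_bigr.
rewrite prod_win.
have E (k : nat) : (\sum_(b : bool) p ^+ letter_energy (k%:Z + 1) b) *
   (\sum_(b : bool) p ^+ letter_energy (- k%:Z) b) = (1 + p ^+ k.+1) ^+ 2.
  have e1 : letter_energy (k%:Z + 1) true = 0%N.
    by rewrite /letter_energy; case: lerP; lia.
  have e2 : letter_energy (k%:Z + 1) false = k.+1.
    by rewrite /letter_energy; case: lerP; lia.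
  have e3 : letter_energy (- k%:Z) true = k.+1.
    by rewrite /letter_energy; case: lerP; lia.
  have e4 : letter_energy (- k%:Z) false = 0%N.
    by rewrite /letter_energy; case: lerP; lia.
  by rewrite !big_bool e1 e2 e3 e4 expr0 /= [p ^+ _ + 1]addrC expr2.
under eq_bigr do rewrite E.
have : \prod_(k < m) (1 + p ^+ k.+1) ^+ 2 <= expR (2 * (p * (1 - p ^+ m)) / (1 - p)).
  elim: m {E} => [|m IHm]; first by rewrite big_ord0 expr0 subrr !mulr0 mul0r expR0.
  rewrite big_ord_recr /=.
  have -> : 2 * (p * (1 - p ^+ m.+1)) / (1 - p) =
            2 * (p * (1 - p ^+ m)) / (1 - p) + p ^+ m.+1 *+ 2.
    have : 1 - p != 0 by rewrite gt_eqF // subr_gt0.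
    by rewrite exprS; move: (p ^+ m) => a ?; field.
  rewrite expRD mulr2n [expR (_ ^+ _ + _)]expRD -expr2 ler_pM //.
  - by rewrite prodr_ge0 // => k _; rewrite exprn_ge0 // addr_ge0 // exprn_ge0 // ltW.
  - by rewrite exprn_ge0 // addr_ge0 // exprn_ge0 // ltW.
  by rewrite lerXn2r ?nnegrE ?expR_ge0 ?expR_ge1Dx // addr_ge0 // exprn_ge0 // ltW.
move/le_trans; apply; rewrite ler_expR ler_pM2r ?invr_gt0 ?subr_gt0 // ler_pM2l //.
apply: ler_piMr; first exact: ltW.
by rewrite lerBlDr lerDl exprn_ge0 // ltW.
Qed.

(** A word of energy e needs at least e/2 swaps, so its coset has mass at most p^e with
    p the square root of q.  The bound on the sum over the words of one window is uniform,
    and the windows exhaust the space. *)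
Lemma mass_bound (q : R) (Q : {measure set (borel Sbal) -> \bar R}) :
  0 < q -> q < 1 ->
  (forall s, exists l, sorting q s l /\ Q [set u | code u = code s] = (q ^+ size l)%:E) ->
  (Q setT < +oo)%E.
Proof.
move=> q0 q1 Ql; pose p := Num.sqrt q.
have p0 : 0 < p by rewrite sqrtr_gt0.
have p2 : p ^+ 2 = q by rewrite sqr_sqrtr // ltW.
have p1 : p < 1 by rewrite -(@ltr_pXn2r _ 2) ?nnegrE ?ler01 ?ltW // p2 expr1n.
pose C := expR (2 * p / (1 - p)).
have tm m : (Q (tame m) <= C%:E)%E.
  (* The words of signs in the window cut its cylinders into finitely many pieces. *)
  pose wd s := [ffun i : 'I_(m + m) => 1 <= act s (nth 0 (win m) i)].
  pose B w := tame m `&` [set s | wd s = w].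
  have wdP s t : tame m s -> tame m t -> wd s = wd t -> code s = code t.
    move=> ts tt st; apply/codeP => j; case: (boolP (j \in win m)) => jm.
      have jl : (index j (win m) < m + m)%N.
        by rewrite -[X in (_ < X)%N](_ : size (win m) = _) ?index_mem // size_map size_iota.
      by move/ffunP: st => /(_ (Ordinal jl)); rewrite !ffunE /= nth_index.
    by move: jm; rewrite mem_win; have [a b] := ts j; have [c d] := tt j; lia.
  have mB w : measurable (B w).
    case: (pselect (exists s, B w s)) => [[s [sm sw]]|nB].
      rewrite (_ : B w = tame m `&` [set u | code u = code s]).
        by apply: measurableI; [exact: measurable_tame|exact: measurable_code].
      apply/seteqP; split=> u [um].
        by move=> uw; split=> //; apply: wdP; rewrite // uw.
      move=> /codeP us; split=> //=; rewrite -sw; apply/ffunP => i.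
      by rewrite !ffunE us.
    rewrite (_ : B w = set0) //; apply/seteqP; split=> s // Bs.
    by apply: nB; exists s.
  have -> : tame m = \big[setU/set0]_(w : {ffun 'I_(m + m) -> bool}) B w.
    have mem_big (r : seq {ffun 'I_(m + m) -> bool}) s :
        (\big[setU/set0]_(w <- r) B w) s <-> exists2 w, w \in r & B w s.
      elim: r => [|w r IHr]; first by rewrite big_nil; split=> // -[].
      rewrite big_cons; split=> [[Bw|/IHr[v vr Bv]]|[v]].
      - by exists w => //; rewrite inE eqxx.
      - by exists v => //; rewrite inE vr orbT.
      - by rewrite inE => /orP[/eqP -> ?|vr Bv]; [left|right; apply/IHr; exists v].
    apply/seteqP; split=> s; last by move/mem_big => [w _ []].
    by move=> sm; apply/mem_big; exists (wd s) => //; rewrite mem_index_enum.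
  apply: le_trans (measure_bigsetU_le _ mB (b := fun w : {ffun 'I_(m + m) -> bool} =>
     \prod_(i < m + m) p ^+ letter_energy (nth 0 (win m) i) (w i)) _) _; last first.
    by rewrite lee_fin; exact: energy_sum_le.
  move=> w; case: (pselect (exists s, B w s)) => [[s [sm sw]]|nB]; last first.
    rewrite (_ : B w = set0); last first.
      by apply/seteqP; split=> s // Bs; apply: nB; exists s.
    by rewrite measure0 lee_fin prodr_ge0 // => i _; rewrite exprn_ge0 // ltW.
  have [l [sl Qs]] := Ql s.
  apply: (@le_trans _ _ (Q [set u | code u = code s])).
    apply: le_measure; rewrite ?inE //; first exact: measurable_code.
    by move=> u [um uw]; apply: wdP; rewrite // uw.
  have [_ sP] := sl s (fun=> erefl); have [_ _ el] := sP m sm.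
  rewrite Qs lee_fin -p2 -exprM prodrXr.
  have -> : (\sum_(i < m + m) letter_energy (nth 0%R (win m) i) (w i) = energy m s)%N.
    rewrite /energy (big_nth 0) size_map size_iota big_mkord; apply: eq_bigr => i _.
    by rewrite -sw ffunE.
  by rewrite ler_iXn2l // ltW.
apply: (@le_lt_trans _ _ C%:E); last exact: ltry.
have cov : \bigcup_m tame m = [set: borel Sbal].
  by apply/seteqP; split=> // s _; have [m sm] := tame_ex s; exists m.
have nd : nondecreasing_seq tame.
  by move=> m n mn; apply/subsetPset => s; exact: tameW.
have cv := @nondecreasing_cvg_mu _ _ R Q tame measurable_tame
  ltac:(rewrite cov; exact: measurableT) nd.
rewrite -cov -(cvg_lim _ cv) //; apply: lime_le; first by apply/cvg_ex; exists (Q (\bigcup_m tame m)).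
by near=> m; exact: tm.
Unshelve. all: by end_near.
Qed.

End mass.

(** Both sides of the scaling rule are finite measures once restricted to ascents, and
    they agree on the cylinders of all windows containing i and i+1. *)
Lemma cylof_weight_exch (R : realType) (q z : R) (Q : {measure set (borel Sbal) -> \bar R}) :
  0 < q -> (Q setT < +oo)%E ->
  (forall m s, tame m s -> Q (cylof m s) = (z * weight q m (act s))%:E) ->
  right_q_exchangeable q Q.
Proof.
move=> q0 Qoo Qw; apply/(right_exchP q0) => i A mA Ai.
pose U := @pos_ascent Sbal i.
have mU : measurable U by exact: (measurable_rel <%R).
have mrU : measurable (right_transl i @^-1` U) by exact: measurable_preright.
pose m1 := image_measure
  (mrestr Q mrU) (@measurable_right Sbal i).
pose m2 := mscale (NngNum (ltW q0)) (mrestr Q mU).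
suff m12 : forall A, measurable A -> m1 A = m2 A.
  have AU : A `&` U = A by exact: setIidl.
  have m1A : m1 A = Q (right_transl i @^-1` (A `&` U)) by [].
  have m2A : m2 A = (q%:E * Q (A `&` U))%E by [].
  by rewrite -AU -m1A -m2A m12.
apply: (@cyl_measure_eq R m1 m2 (absz i).+2).
  apply: le_lt_trans Qoo; apply: le_measure; rewrite ?inE //.
  by apply: measurableI => //; rewrite preimage_setT.
move=> m l im.
case: (pselect (exists s, cyl m l s)) => [[s sl]|nl]; last first.
  have -> : cyl m l = set0 by apply/seteqP; split=> s // sl; exfalso; apply: nl; exists s.
  by rewrite !measure0.
rewrite (cyl_cylof sl); have sm : tame m s by case: sl.
have iw : i \in win m by rewrite mem_win; lia.
have i1w : i + 1 \in win m by rewrite mem_win; lia.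
change (Q (right_transl i @^-1` (cylof m s `&` U)) = (q%:E * Q (cylof m s `&` U))%E).
case: (ltP (act s i) (act s (i + 1))) => si.
  rewrite setIidl; last by move=> u /cylofP[_ us]; rewrite /U /pos_ascent /= !us.
  rewrite cylof_right // Qw; last exact: tame_right.
  rewrite Qw // -EFinM; congr EFin; rewrite [RHS]mulrCA; congr (_ * _).
  exact: (@weight_swap R q m i (act s)).
rewrite (_ : _ `&` _ = set0) ?preimage_set0 ?measure0 ?mule0 //.
apply/seteqP; split=> u // [/cylofP[_ us]]; rewrite /U /pos_ascent /= !us //.
by rewrite ltNge si.
Qed.

(* Equality of measures is equality on measurable sets: the library's measures
   are functions on all sets, unconstrained off the sigma-algebra. *)
Theorem theorem3p3 (R : realType) (q : R) (q_gt0 : 0 < q) (q_lt1 : q < 1) :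
  (forall mu : {measure set (borel Sadm) -> \bar R},
     right_q_exchangeable q mu <-> left_q_exchangeable q mu) /\
  (exists Q : probability (borel Sbal) R,
     (right_q_exchangeable q Q /\ left_q_exchangeable q Q) /\
     forall Q' : probability (borel Sbal) R,
       right_q_exchangeable q Q' -> left_q_exchangeable q Q' ->
       forall A : set (borel Sbal), measurable A -> Q' A = Q A).
Proof.
split=> [mu|]; first exact: right_iff_left.
have [Q0 [Qw Qc]] := mallows_sum q_gt0 q_lt1.
have Qoo := mass_bound q_gt0 q_lt1 Qc.
have Q0T : (0 < Q0 setT)%E.
  apply: (@lt_le_trans _ _ (Q0 (cylof 0 bal1))).
    by rewrite Qw ?lte_fin ?weight_gt0 //; exact: tame_bal1.
  by apply: le_measure; rewrite ?inE //; exact: measurable_cylof.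
have Qfin : Q0 setT \is a fin_num by rewrite ge0_fin_numE ?measure_ge0.
pose Q : probability (borel Sbal) R := mnormalize Q0 (@dirac _ (borel Sbal) bal1 R).
pose z := (fine (Q0 setT))^-1.
have z0 : 0 < z by rewrite invr_gt0 fine_gt0 // Q0T Qoo.
have QE m s : tame m s -> Q (cylof m s) = (z * weight q m (act s))%:E.
  move=> sm; rewrite /Q /= /mnormalize gt_eqF // lt_eqF //= Qw // -EFinM.
  by rewrite mulrC.
have Qr : right_q_exchangeable q Q.
  apply: (cylof_weight_exch (z := z)) => //.
  exact: le_lt_trans (probability_le1 Q measurableT) (ltry _).
exists Q; split; first by split=> //; apply/(right_iff_left q_gt0).
by move=> Q' Q'r Q'l; exact: (exch_unique q_gt0 q_lt1 z0 QE Q'r Q'l).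
Qed.
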